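(* Let $k$ be a field of characteristic $p>0$, let $R=k[x_1,\dots,x_d]$ be a polynomial ring or $R=k[[x_1,\dots,x_d]]$ a formal power series ring over $k$, and let $f\in R$ be non-zero. Then $R_f$ is generated as a $D_{R|k}$-module by $\frac{1}{f}$, i.e. $D_{R|k}\cdot\frac{1}{f}=R_f$.
   Context: For a commutative ring $R$, differential operators $\delta:R\to R$ of order $\le n$ are defined inductively: those of order $0$ are the multiplications $\tilde r$ by elements $r\in R$; a differential operator of order $\le n$ is an additive map $\delta:R\to R$ such that for every $r\in R$ the commutator $\delta\circ\tilde r-\tilde r\circ\delta$ is a differential operator of order $\le n-1$. All differential operators form a ring $D_R$ under addition and composition, and for a subring $k\subseteq R$, $D_{R|k}\subseteq D_R$ is the subring of $k$-linear differential operators. $D_{R|k}$-modules are left modules. $R_f$ denotes the localization of $R$ obtained by inverting $f$; it carries the unique $D_{R|k}$-module structure for which the localization map $R\to R_f$ is $D_{R|k}$-linear. *)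

(* Defs.v *)
From HB Require Import structures.
From mathcomp Require Import all_boot all_order all_algebra generic_quotient.
From mathcomp Require Import boolp.
From mathcomp Require Import mpoly.
From mathcomp Require Import ring.

Set Implicit Arguments.
Unset Strict Implicit.
Unset Printing Implicit Defensive.

Import GRing.Theory.
Local Open Scope ring_scope.
Local Open Scope quotient_scope.

Section DiffOp.
Variable R : comPzRingType.
Implicit Types (r s : R) (h g : R -> R).

Definition commr_op h r : R -> R := fun x => h (r * x) - r * h x.

Fixpoint is_diffop n h : Prop :=
  match n with
  | 0 => exists r, h = *%R r
  | n'.+1 => {morph h : x y / x + y} /\ forall r, is_diffop n' (commr_op h r)
  end.

Lemma is_diffop_morph n h : is_diffop n h -> {morph h : x y / x + y}.
Proof. by case: n => [[r ->] x y|n []//]; rewrite mulrDr. Qed.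

Lemma morph_add0 h : {morph h : x y / x + y} -> h 0 = 0.
Proof. by move=> hD; apply: (addIr (h 0)); rewrite -hD !add0r. Qed.

Lemma morph_addN h : {morph h : x y / x + y} -> {morph h : x / - x}.
Proof.
move=> hD x; apply: (addIr (h x)).
by rewrite -hD !addNr (morph_add0 hD).
Qed.

Lemma is_diffopS n h : is_diffop n h -> is_diffop n.+1 h.
Proof.
elim: n h => [|n IHn] h H; (split; first exact: is_diffop_morph H) => r.
  case: H => s ->; exists 0; apply/funext => x; rewrite /commr_op; ring.
exact/IHn/H.2.
Qed.

Lemma is_diffop_leq m n h : (m <= n)%N -> is_diffop m h -> is_diffop n h.
Proof.
move=> /subnK <-; elim: (n - m)%N => // i IHi H; rewrite addSn.
exact/is_diffopS/IHi.
Qed.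

Lemma is_diffopD n h g :
  is_diffop n h -> is_diffop n g -> is_diffop n (fun x => h x + g x).
Proof.
elim: n h g => [|n IHn] h g.
  by move=> [r ->] [s ->]; exists (r + s); apply/funext => x; rewrite mulrDl.
move=> [hD hc] [gD gc]; split=> [x y|r]; first by rewrite hD gD; ring.
suff -> : commr_op (fun x => h x + g x) r =
          fun x => commr_op h r x + commr_op g r x by exact: IHn (hc r) (gc r).
by apply/funext => x; rewrite /commr_op; ring.
Qed.

Lemma is_diffopMl n h r : is_diffop n h -> is_diffop n (fun x => r * h x).
Proof.
elim: n h => [|n IHn] h.
  by move=> [s ->]; exists (r * s); apply/funext => x; rewrite mulrA.
move=> [hD hc]; split=> [x y|s]; first by rewrite hD; ring.
suff -> : commr_op (fun x => r * h x) s = fun x => r * commr_op h s x.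
  exact: IHn (hc s).
by apply/funext => x; rewrite /commr_op; ring.
Qed.

Lemma is_diffopMr n h r : is_diffop n h -> is_diffop n (fun x => h (r * x)).
Proof.
elim: n h => [|n IHn] h.
  by move=> [s ->]; exists (s * r); apply/funext => x; rewrite mulrA.
move=> [hD hc]; split=> [x y|s]; first by rewrite mulrDr hD.
suff -> : commr_op (fun x => h (r * x)) s = fun x => commr_op h s (r * x).
  exact: IHn (hc s).
by apply/funext => x; rewrite /commr_op (mulrCA r).
Qed.

Lemma is_diffopN n h : is_diffop n h -> is_diffop n (fun x => - h x).
Proof.
move=> /(@is_diffopMl _ _ (-1)); congr is_diffop.
by apply/funext => x; rewrite mulN1r.
Qed.

Lemma is_diffopB n h g :
  is_diffop n h -> is_diffop n g -> is_diffop n (fun x => h x - g x).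
Proof. by move=> H /is_diffopN; apply: is_diffopD. Qed.

Lemma is_diffop_comp m n h g :
  is_diffop m h -> is_diffop n g -> is_diffop (m + n) (h \o g).
Proof.
elim: m n h g => [|m IHm] n h g.
  by move=> [r ->]; rewrite add0n; apply: is_diffopMl.
elim: n g => [|n IHn] g.
  by move=> H [r ->]; rewrite addn0; apply: is_diffopMr.
move=> H G; have [hD hc] := H; have [gD gc] := G.
rewrite addnS; split=> [x y|r] /=; first by rewrite gD hD.
suff -> : commr_op (h \o g) r =
          fun x => (h \o commr_op g r) x + (commr_op h r \o g) x.
  apply: (@is_diffopD (m.+1 + n)); first exact/IHn/gc.
  by rewrite addSn -addnS; apply: IHm; first exact: hc.
apply/funext => x; rewrite /commr_op /= hD (morph_addN hD); ring.
Qed.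

Lemma is_diffop_mul r : is_diffop 0 ( *%R r).
Proof. by exists r. Qed.

End DiffOp.

(* diffop R is the ring D_{R|k}, for R a commutative k-algebra: its product is *)
(* composition, and the order of an operator is measured among all additive   *)
(* maps R -> R, not just among the k-linear ones.                             *)

Section DiffOpRing.
Variables (k : comNzRingType) (R : comAlgType k).

Record diffop := Diffop {
  diffop_fun :> R -> R;
  diffop_scalable : forall (c : k) (x : R),
    diffop_fun (c *: x) = c *: diffop_fun x;
  diffop_order : exists n, is_diffop n diffop_fun }.

HB.instance Definition _ := gen_eqMixin diffop.
HB.instance Definition _ := gen_choiceMixin diffop.

Implicit Types u v w : diffop.

Lemma diffop_eq u v : u =1 v -> u = v.
Proof.
case: u v => [u ul uo] [v vl vo] /= /funext uv; subst v.
by congr Diffop; apply: Prop_irrelevance.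
Qed.

Lemma diffop_morph u : {morph u : x y / x + y}.
Proof. by have [n /is_diffop_morph] := diffop_order u. Qed.

Fact diffop_mul_scalable (r : R) (c : k) x : r * (c *: x) = c *: (r * x).
Proof. by rewrite scalerAr. Qed.
Fact diffop_mul_order (r : R) : exists n, is_diffop n ( *%R r).
Proof. by exists 0; exact: is_diffop_mul. Qed.
Definition diffop_mul (r : R) : diffop :=
  Diffop (diffop_mul_scalable r) (diffop_mul_order r).

Fact diffop_add_scalable u v (c : k) x :
  u (c *: x) + v (c *: x) = c *: (u x + v x).
Proof. by rewrite !diffop_scalable scalerDr. Qed.
Fact diffop_add_order u v : exists n, is_diffop n (fun x => u x + v x).
Proof.
have [[m um] [n vn]] := (diffop_order u, diffop_order v); exists (m + n)%N.
apply: is_diffopD; [move: um | move: vn]; apply: is_diffop_leq.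
  exact: leq_addr.
exact: leq_addl.
Qed.
Definition diffop_add u v : diffop :=
  Diffop (diffop_add_scalable u v) (diffop_add_order u v).

Fact diffop_opp_scalable u (c : k) x : - u (c *: x) = c *: (- u x).
Proof. by rewrite diffop_scalable scalerN. Qed.
Fact diffop_opp_order u : exists n, is_diffop n (fun x => - u x).
Proof. by have [n /is_diffopN un] := diffop_order u; exists n. Qed.
Definition diffop_opp u : diffop :=
  Diffop (diffop_opp_scalable u) (diffop_opp_order u).

Fact diffop_comp_scalable u v (c : k) x : u (v (c *: x)) = c *: u (v x).
Proof. by rewrite !diffop_scalable. Qed.
Fact diffop_comp_order u v : exists n, is_diffop n (u \o v).
Proof.
have [[m um] [n vn]] := (diffop_order u, diffop_order v); exists (m + n)%N.
exact: is_diffop_comp.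
Qed.
Definition diffop_comp u v : diffop :=
  Diffop (diffop_comp_scalable u v) (diffop_comp_order u v).

Fact diffop_addA : associative diffop_add.
Proof. by move=> u v w; apply: diffop_eq => x /=; rewrite addrA. Qed.
Fact diffop_addC : commutative diffop_add.
Proof. by move=> u v; apply: diffop_eq => x /=; rewrite addrC. Qed.
Fact diffop_add0 : left_id (diffop_mul 0) diffop_add.
Proof. by move=> u; apply: diffop_eq => x /=; rewrite mul0r add0r. Qed.
Fact diffop_addN : left_inverse (diffop_mul 0) diffop_opp diffop_add.
Proof. by move=> u; apply: diffop_eq => x /=; rewrite mul0r addNr. Qed.

HB.instance Definition _ := GRing.isZmodule.Build diffop
  diffop_addA diffop_addC diffop_add0 diffop_addN.

Fact diffop_compA : associative diffop_comp.
Proof. by move=> u v w; apply: diffop_eq. Qed.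
Fact diffop_comp1 : left_id (diffop_mul 1) diffop_comp.
Proof. by move=> u; apply: diffop_eq => x /=; rewrite mul1r. Qed.
Fact diffop_comp1r : right_id (diffop_mul 1) diffop_comp.
Proof. by move=> u; apply: diffop_eq => x /=; rewrite mul1r. Qed.
Fact diffop_compDl : left_distributive diffop_comp +%R.
Proof. by move=> u v w; apply: diffop_eq. Qed.
Fact diffop_compDr : right_distributive diffop_comp +%R.
Proof. by move=> u v w; apply: diffop_eq => x /=; rewrite diffop_morph. Qed.

HB.instance Definition _ := GRing.Zmodule_isPzRing.Build diffop
  diffop_compA diffop_comp1 diffop_comp1r diffop_compDl diffop_compDr.

Lemma diffopD u v x : (u + v) x = u x + v x. Proof. by []. Qed.
Lemma diffopM u v x : (u * v) x = u (v x). Proof. by []. Qed.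
Lemma diffop1 x : (1 : diffop) x = x. Proof. by rewrite [LHS]mul1r. Qed.

End DiffOpRing.

Section Localization.
Variables (R : comPzRingType) (f : R).

(* The pair (a, m) stands for the fraction a / f ^+ m.                        *)
Definition loc_rel (x y : R * nat) : bool :=
  `[< exists l, f ^+ l * (f ^+ y.2 * x.1) = f ^+ l * (f ^+ x.2 * y.1) >].

Fact loc_rel_refl : reflexive loc_rel.
Proof. by move=> x; apply/asboolP; exists 0. Qed.
Fact loc_rel_sym : ssrbool.symmetric loc_rel.
Proof. by move=> x y; apply/asboolP/asboolP => -[l e]; exists l. Qed.
Fact loc_rel_trans : transitive loc_rel.
Proof.
move=> [b n] [a m] [c l] /asboolP[i /= e1] /asboolP[j /= e2].
apply/asboolP; exists (i + j + n)%N; rewrite /= !exprD.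
transitivity (f ^+ j * f ^+ l * (f ^+ i * (f ^+ n * a))); first by ring.
rewrite e1; transitivity (f ^+ i * f ^+ m * (f ^+ j * (f ^+ l * b))).
  by ring.
by rewrite e2; ring.
Qed.

Canonical loc_equiv := EquivRel loc_rel loc_rel_refl loc_rel_sym loc_rel_trans.

Definition localization := {eq_quot loc_equiv}.

HB.instance Definition _ := Choice.on localization.
HB.instance Definition _ := EqQuotient.on localization.

(* locfrac a m is a / f ^+ m.                                                 *)
Definition locfrac (a : R) (m : nat) : localization :=
  \pi_localization (a, m).

Lemma locfracP a m b n :
  locfrac a m = locfrac b n <->
  exists l, f ^+ l * (f ^+ n * a) = f ^+ l * (f ^+ m * b).
Proof.
split=> [/eqP|e]; last apply/eqP; rewrite eqmodE; last exact/asboolP.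
by move=> /asboolP.
Qed.

Lemma locfracW (x : localization) : exists a m, x = locfrac a m.
Proof.
by exists (repr x).1, (repr x).2; rewrite /locfrac -surjective_pairing reprK.
Qed.

Definition loc_add (x y : localization) : localization :=
  let: ((a, m), (b, n)) := (repr x, repr y) in
  locfrac (f ^+ n * a + f ^+ m * b) (m + n).
Definition loc_opp (x : localization) : localization :=
  let: (a, m) := repr x in locfrac (- a) m.
Definition loc_mul (x y : localization) : localization :=
  let: ((a, m), (b, n)) := (repr x, repr y) in locfrac (a * b) (m + n).

Lemma repr_locfrac a m : exists b n,
  repr (locfrac a m) = (b, n) /\
  exists l, f ^+ l * (f ^+ m * b) = f ^+ l * (f ^+ n * a).
Proof.
case e: (repr (locfrac a m)) => [b n]; exists b, n; split => //.
by apply/locfracP; rewrite {1}/locfrac -e reprK.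
Qed.

Lemma loc_addE a m b n : loc_add (locfrac a m) (locfrac b n) =
  locfrac (f ^+ n * a + f ^+ m * b) (m + n).
Proof.
rewrite /loc_add; have [a' [m' [-> [i ei]]]] := repr_locfrac a m.
have [b' [n' [-> [j ej]]]] := repr_locfrac b n.
apply/locfracP; exists (i + j)%N; rewrite !exprD.
transitivity (f ^+ j * f ^+ n * f ^+ n' * (f ^+ i * (f ^+ m * a')) +
              f ^+ i * f ^+ m * f ^+ m' * (f ^+ j * (f ^+ n * b'))).
  by ring.
by rewrite ei ej; ring.
Qed.

Lemma loc_oppE a m : loc_opp (locfrac a m) = locfrac (- a) m.
Proof.
rewrite /loc_opp; have [a' [m' [-> [i ei]]]] := repr_locfrac a m.
by apply/locfracP; exists i; rewrite !mulrN ei.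
Qed.

Lemma loc_mulE a m b n : loc_mul (locfrac a m) (locfrac b n) =
  locfrac (a * b) (m + n).
Proof.
rewrite /loc_mul; have [a' [m' [-> [i ei]]]] := repr_locfrac a m.
have [b' [n' [-> [j ej]]]] := repr_locfrac b n.
apply/locfracP; exists (i + j)%N; rewrite !exprD.
transitivity ((f ^+ i * (f ^+ m * a')) * (f ^+ j * (f ^+ n * b'))).
  by ring.
by rewrite ei ej; ring.
Qed.

Lemma locfrac_eq a m b n : f ^+ n * a = f ^+ m * b -> locfrac a m = locfrac b n.
Proof. by move=> e; apply/locfracP; exists 0; rewrite e. Qed.

Fact loc_addA : associative loc_add.
Proof.
move=> x y z; have [a [m ->]] := locfracW x; have [b [n ->]] := locfracW y.
have [c [l ->]] := locfracW z; rewrite !loc_addE.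
by apply: locfrac_eq; rewrite !exprD; ring.
Qed.
Fact loc_addC : commutative loc_add.
Proof.
move=> x y; have [a [m ->]] := locfracW x; have [b [n ->]] := locfracW y.
by rewrite !loc_addE; apply: locfrac_eq; rewrite !exprD; ring.
Qed.
Fact loc_add0 : left_id (locfrac 0 0) loc_add.
Proof.
move=> x; have [a [m ->]] := locfracW x.
by rewrite !loc_addE; apply: locfrac_eq; rewrite add0n expr0; ring.
Qed.
Fact loc_addN : left_inverse (locfrac 0 0) loc_opp loc_add.
Proof.
move=> x; have [a [m ->]] := locfracW x.
by rewrite loc_oppE !loc_addE; apply: locfrac_eq; rewrite expr0; ring.
Qed.

HB.instance Definition _ := GRing.isZmodule.Build localization
  loc_addA loc_addC loc_add0 loc_addN.

Fact loc_mulA : associative loc_mul.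
Proof.
move=> x y z; have [a [m ->]] := locfracW x; have [b [n ->]] := locfracW y.
have [c [l ->]] := locfracW z; rewrite !loc_mulE.
by apply: locfrac_eq; rewrite !exprD; ring.
Qed.
Fact loc_mulC : commutative loc_mul.
Proof.
move=> x y; have [a [m ->]] := locfracW x; have [b [n ->]] := locfracW y.
by rewrite !loc_mulE; apply: locfrac_eq; rewrite !exprD; ring.
Qed.
Fact loc_mul1 : left_id (locfrac 1 0) loc_mul.
Proof.
move=> x; have [a [m ->]] := locfracW x.
by rewrite !loc_mulE; apply: locfrac_eq; rewrite add0n mul1r.
Qed.
Fact loc_mulD : left_distributive loc_mul +%R.
Proof.
move=> x y z; have [a [m ->]] := locfracW x; have [b [n ->]] := locfracW y.
have [c [l ->]] := locfracW z; rewrite /+%R /= !(loc_addE, loc_mulE) .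
by apply: locfrac_eq; rewrite !exprD; ring.
Qed.

HB.instance Definition _ := GRing.Zmodule_isComPzRing.Build localization
  loc_mulA loc_mulC loc_mul1 loc_mulD.

Definition loc_inj (a : R) : localization := locfrac a 0.

Lemma locfracM a m b n : locfrac a m * locfrac b n = locfrac (a * b) (m + n).
Proof. exact: loc_mulE. Qed.

Fact loc_injD : {morph loc_inj : a b / a + b}.
Proof.
move=> a b; rewrite /loc_inj [RHS]loc_addE.
by apply: locfrac_eq; rewrite !expr0; ring.
Qed.
Fact loc_inj_zmod : zmod_morphism loc_inj.
Proof.
by move=> a b; rewrite loc_injD; congr (_ + _); rewrite /loc_inj [RHS]loc_oppE.
Qed.
Fact loc_inj_monoid : monoid_morphism loc_inj.
Proof. by split=> // a b; rewrite locfracM. Qed.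

HB.instance Definition _ := GRing.isZmodMorphism.Build R localization loc_inj
  loc_inj_zmod.
HB.instance Definition _ := GRing.isMonoidMorphism.Build R localization loc_inj
  loc_inj_monoid.

Lemma locfracVl m : locfrac 1 m * loc_inj (f ^+ m) = 1.
Proof.
rewrite locfracM mul1r addn0; apply: locfrac_eq.
by rewrite expr0 mul1r mulr1.
Qed.

Lemma locfracK a m : loc_inj (f ^+ m) * locfrac a m = loc_inj a.
Proof. by rewrite locfracM; apply: locfrac_eq; rewrite expr0 mul1r. Qed.

Lemma loc_lreg m (x y : localization) :
  loc_inj (f ^+ m) * x = loc_inj (f ^+ m) * y -> x = y.
Proof.
by move=> e; rewrite -[x]mul1r -[y]mul1r -(locfracVl m) -!mulrA e.
Qed.

Lemma loc_inj_eq0 a : loc_inj a = 0 -> exists m, f ^+ m * a = 0.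
Proof.
by move=> /locfracP[l]; rewrite expr0 !mul1r mulr0 => e; exists l.
Qed.

End Localization.

Section Extension.
Variables (R : comPzRingType) (f : R).
Local Notation Rf := (localization f).
Local Notation inj := (loc_inj f).
Implicit Types (h : R -> R) (g : Rf -> Rf).

Definition extends_op h g := forall a, g (inj a) = inj (h a).

Lemma diffop_loc_eq0 n g :
  is_diffop n g -> (forall a, g (inj a) = 0) -> forall x, g x = 0.
Proof.
elim: n g => [|n IHn] g.
  by move=> [y ->] /(_ 1); rewrite rmorph1 mulr1 => -> x; rewrite mul0r.
move=> [gD gc] g0 x; have [a [m ->]] := locfracW x.
apply: (@loc_lreg _ _ m); rewrite mulr0.
have := IHn _ (gc (inj (f ^+ m))); rewrite /commr_op => /(_ _ (locfrac f a m)).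
rewrite locfracK g0 sub0r => H; apply/eqP; rewrite -oppr_eq0; apply/eqP/H => b.
by rewrite -rmorphM !g0 mulr0 subr0.
Qed.

Lemma extends_op_unique m n h g g' : is_diffop m g -> is_diffop n g' ->
  extends_op h g -> extends_op h g' -> g = g'.
Proof.
move=> gm gn eg eg'; apply/funext => x; apply/eqP; rewrite -subr_eq0; apply/eqP.
apply: (@diffop_loc_eq0 (m + n) (fun x => g x - g' x)) => [|a]; last first.
  by rewrite eg eg' subrr.
apply: is_diffopB; [move: gm | move: gn]; apply: is_diffop_leq.
  exact: leq_addr.
exact: leq_addl.
Qed.

Lemma diffop_loc_inj_eq0 n h a : is_diffop n h -> inj a = 0 -> inj (h a) = 0.
Proof.
elim: n h => [|n IHn] h.
  by move=> [r ->] a0; rewrite rmorphM /= a0 mulr0.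
move=> [hD hc] a0; have [m fa0] := loc_inj_eq0 a0.
have := IHn _ (hc (f ^+ m)) a0; rewrite /commr_op fa0 (morph_add0 hD) sub0r.
move=> /eqP; rewrite rmorphN oppr_eq0 rmorphM => /eqP e.
by apply: (@loc_lreg _ _ m); rewrite mulr0.
Qed.

Lemma diffop_loc_inj_eq n h a b :
  is_diffop n h -> inj a = inj b -> inj (h a) = inj (h b).
Proof.
move=> hn e; have hD := is_diffop_morph hn.
apply/eqP; rewrite -subr_eq0 -rmorphB -(morph_addN hD) -hD; apply/eqP.
by apply: diffop_loc_inj_eq0 hn _; rewrite rmorphB /= e subrr.
Qed.

Lemma extends_op_exists n h :
  is_diffop n h -> exists g, is_diffop n g /\ extends_op h g.
Proof.
elim: n h => [|n IHn] h.
  move=> [r ->]; exists ( *%R (inj r)); split; first by exists (inj r).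
  by move=> a; rewrite rmorphM.
move=> hn; have [hD hc] := hn.
have /boolp.choice[E EP] : forall r, exists g : Rf -> Rf,
    is_diffop n g /\ extends_op (commr_op h r) g.
  by move=> r; apply/IHn/hc.
have Ed r := (EP r).1; have Ee r := (EP r).2.
have EM r s x : E (r * s) x = E r (inj s * x) + inj r * E s x.
  suff -> : E (r * s) = fun x => E r (inj s * x) + inj r * E s x by [].
  apply: (@extends_op_unique n n (commr_op h (r * s))) => //; last first.
    move=> a; rewrite -rmorphM !Ee -rmorphM -rmorphD; congr inj.
    by rewrite /commr_op !mulrA; ring.
  exact: (is_diffopD (is_diffopMr _ (Ed r)) (is_diffopMl _ (Ed s))).
pose v a m : Rf := locfrac f 1 m * (inj (h a) - E (f ^+ m) (locfrac f a m)).
pose g (x : Rf) := v (repr x).1 (repr x).2.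
have key a m x : inj (f ^+ m) * x = inj a ->
    inj (f ^+ m) * g x = inj (h a) - E (f ^+ m) x.
  move=> e; rewrite /g; case er: (repr x) => [b l] /=.
  have xb : x = locfrac f b l by rewrite /locfrac -er reprK.
  have e' : inj (f ^+ l) * x = inj b by rewrite xb locfracK.
  have step c i j : inj (f ^+ i) * x = inj c ->
      inj (f ^+ j) * (inj (h c) - E (f ^+ i) x) =
      inj (h (f ^+ j * c)) - E (f ^+ (i + j)) x.
    move=> ec; rewrite (addnC i) exprD EM ec Ee /commr_op rmorphB rmorphM /=.
    by ring.
  apply: (@loc_lreg _ _ l); rewrite (step _ _ _ e) /v -xb.
  rewrite [in LHS]mulrCA (mulrA (inj (f ^+ l))) (mulrC (inj (f ^+ l))) locfracVl.
  rewrite mul1r (step _ _ _ e') (addnC l); congr (_ - _).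
  apply: (diffop_loc_inj_eq hn).
  by rewrite !rmorphM /= -e -e' mulrCA.
have gE a m : inj (f ^+ m) * g (locfrac f a m) =
    inj (h a) - E (f ^+ m) (locfrac f a m).
  by apply: key; rewrite locfracK.
clearbody g; clear v.
have gc r x : g (inj r * x) = inj r * g x + E r x.
  have [a [m ->]] := locfracW x; set y := locfrac f a m.
  have ey : inj (f ^+ m) * y = inj a by exact: locfracK.
  have gy : inj (f ^+ m) * g y = inj (h a) - E (f ^+ m) y by exact: gE.
  apply: (@loc_lreg _ _ m); rewrite mulrDr mulrCA gy.
  rewrite (@key (r * a)); last by rewrite mulrCA ey rmorphM.
  have := EM r (f ^+ m) y; rewrite mulrC EM ey Ee /commr_op rmorphB rmorphM /=.
  rewrite -/y => e; apply/eqP; rewrite -subr_eq0.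
  have {e}-> : inj (h (r * a)) = E (f ^+ m) (inj r * y) + inj (f ^+ m) * E r y
      - inj r * E (f ^+ m) y + inj r * inj (h a) by rewrite e; ring.
  by apply/eqP; ring.
exists g; split; last first.
  move=> a; have := gE a 0; rewrite expr0 rmorph1 mul1r /loc_inj => ->.
  by rewrite [E _ _]Ee /commr_op !mul1r subrr rmorph0 subr0.
have gD : {morph g : x y / x + y}.
  move=> x y; have [a [m ->]] := locfracW x; have [b [l ->]] := locfracW y.
  set x' := locfrac f a m; set y' := locfrac f b l.
  have ex : inj (f ^+ (m + l)) * x' = inj (f ^+ l * a).
    by rewrite exprD !rmorphM /= mulrAC locfracK mulrC.
  have ey : inj (f ^+ (m + l)) * y' = inj (f ^+ m * b).
    by rewrite exprD !rmorphM /= -mulrA locfracK.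
  apply: (@loc_lreg _ _ (m + l)); rewrite mulrDr (key _ _ _ ex) (key _ _ _ ey).
  rewrite (@key (f ^+ l * a + f ^+ m * b)); last by rewrite mulrDr ex ey rmorphD.
  by rewrite hD rmorphD (is_diffop_morph (Ed _)); ring.
split=> // y; have [r [m ->]] := locfracW y.
suff -> : commr_op g (locfrac f r m) =
    fun x => locfrac f 1 m * (E r x - E (f ^+ m) (locfrac f r m * x)).
  by apply/is_diffopMl/is_diffopB => //; apply: is_diffopMr.
apply/funext => x; apply: (@loc_lreg _ _ m); rewrite /commr_op.
rewrite (mulrA _ _ (_ - _)) (mulrC (inj _) (locfrac f 1 m)) locfracVl mul1r.
rewrite mulrBr (mulrA _ _ (g x)) locfracK.
have := gc (f ^+ m) (locfrac f r m * x); rewrite mulrA locfracK gc => e.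
have -> : inj (f ^+ m) * g (locfrac f r m * x) =
  inj r * g x + E r x - E (f ^+ m) (locfrac f r m * x) by rewrite e; ring.
by ring.
Qed.

End Extension.

Section LocModule.
Variables (k : comNzRingType) (R : comAlgType k) (f : R).
Local Notation D := (diffop R).
Local Notation Rf := (localization f).
Implicit Types (u v : D) (x y : Rf).

(* u extends uniquely to a differential operator on R_f, which is the action  *)
(* of u on R_f.                                                               *)
Fact loc_act_subproof u :
  exists g : Rf -> Rf, (exists n, is_diffop n g) /\ extends_op u g.
Proof.
have [n /(extends_op_exists f)[g [gn gu]]] := diffop_order u.
by exists g; split; first exists n.
Qed.
Definition loc_act u : Rf -> Rf := sval (cid (loc_act_subproof u)).

Lemma loc_act_order u : exists n, is_diffop n (loc_act u).
Proof. exact: (svalP (cid (loc_act_subproof u))).1. Qed.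

Lemma loc_act_inj u a : loc_act u (loc_inj f a) = loc_inj f (u a).
Proof. exact: (svalP (cid (loc_act_subproof u))).2. Qed.

Lemma loc_act_eq n u (g : Rf -> Rf) :
  is_diffop n g -> extends_op u g -> loc_act u = g.
Proof.
move=> gn eg; have [m um] := loc_act_order u.
exact: extends_op_unique um gn (loc_act_inj u) eg.
Qed.

Lemma loc_act_mul (r : R) x : loc_act (diffop_mul r) x = loc_inj f r * x.
Proof.
rewrite (@loc_act_eq 0 _ ( *%R (loc_inj f r))) //; first by exists (loc_inj f r).
by move=> a; rewrite -rmorphM.
Qed.

Fact loc_actA u v x : loc_act u (loc_act v x) = loc_act (u * v) x.
Proof.
have [[m um] [n vn]] := (loc_act_order u, loc_act_order v).
rewrite (loc_act_eq (u := u * v) (is_diffop_comp um vn)) // => a /=.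
by rewrite !loc_act_inj.
Qed.
Fact loc_act1 : left_id 1 loc_act.
Proof. by move=> x; rewrite loc_act_mul rmorph1 mul1r. Qed.
Fact loc_actDr : right_distributive loc_act +%R.
Proof. by move=> u; have [n /is_diffop_morph] := loc_act_order u. Qed.
Fact loc_actDl x : {morph loc_act^~ x : u v / u + v}.
Proof.
move=> u v; have [[m um] [n vn]] := (loc_act_order u, loc_act_order v).
rewrite (@loc_act_eq (m + n) (u + v) (fun x => loc_act u x + loc_act v x)) //.
  apply: is_diffopD; [move: um | move: vn]; apply: is_diffop_leq.
    exact: leq_addr.
  exact: leq_addl.
by move=> a; rewrite !loc_act_inj -rmorphD.
Qed.

HB.instance Definition _ := GRing.Zmodule_isLmodule.Build (diffop R)
  (localization f) loc_actA loc_act1 loc_actDr loc_actDl.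

Lemma loc_inj_linear u a : u *: loc_inj f a = loc_inj f (u a).
Proof. exact: loc_act_inj. Qed.

Lemma loc_scale_mul (r : R) x : diffop_mul r *: x = loc_inj f r * x.
Proof. exact: loc_act_mul. Qed.

(* This is the only D_{R|k}-module structure that extends the R-module        *)
(* structure of R_f and makes the localization map linear.                    *)
Lemma loc_scale_unique (act : D -> Rf -> Rf) :
    (forall u v x, act (u * v) x = act u (act v x)) ->
    (forall u v x, act (u + v) x = act u x + act v x) ->
    (forall (r : R) x, act (diffop_mul r) x = loc_inj f r * x) ->
    (forall u a, act u (loc_inj f a) = loc_inj f (u a)) ->
  forall u x, act u x = u *: x.
Proof.
move=> actM actD act_mul act_inj u; have [n un] := diffop_order u.
elim: n u un => [|n IHn] u.
  move=> [r ur] x; suff -> : u = diffop_mul r by rewrite act_mul loc_scale_mul.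
  by apply: diffop_eq => y; rewrite ur.
move=> [uD uc] x; have [a [m ->]] := locfracW x; set y := locfrac f a m.
pose s := diffop_mul (f ^+ m); pose w : D := u * s - s * u.
have {}IHn := IHn w (uc (f ^+ m)).
have e : u * s = w + s * u by rewrite subrK.
apply: (@loc_lreg _ _ m); apply: (addrI (w *: y)).
rewrite -[in LHS]IHn -act_mul -actM -actD -e -loc_scale_mul scalerA -scalerDl -e.
by rewrite actM act_mul -scalerA loc_scale_mul /y locfracK act_inj loc_inj_linear.
Qed.

End LocModule.

(* A series is identified with its coefficients, indexed by exponent vectors. *)
Definition mpseries (k : Type) (d : nat) := 'X_{1..d} -> k.

Section PowerSeries.
Variables (k : comNzRingType) (d : nat).
Local Notation ps := (mpseries k d).
Implicit Types F G H : ps.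

HB.instance Definition _ := gen_eqMixin ps.
HB.instance Definition _ := gen_choiceMixin ps.

Definition mps_zero : ps := fun=> 0.
Definition mps_opp F : ps := fun m => - F m.
Definition mps_add F G : ps := fun m => F m + G m.
Definition mps_one : ps := fun m => (m == 0%MM)%:R.
(* The sum ranges over all (u, v) with u + v = m; such u and v have degree    *)
(* less than (mdeg m).+1, so their number is finite.                          *)
Definition mps_mul F G : ps := fun m =>
  \sum_(u : 'X_{1..d < (mdeg m).+1, (mdeg m).+1} | m == (u.1 + u.2)%MM)
    F u.1 * G u.2.
Definition mps_scale (c : k) F : ps := fun m => c * F m.

Fact mps_addA : associative mps_add.
Proof. by move=> F G H; apply/funext => m; apply: addrA. Qed.
Fact mps_addC : commutative mps_add.
Proof. by move=> F G; apply/funext => m; apply: addrC. Qed.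
Fact mps_add0 : left_id mps_zero mps_add.
Proof. by move=> F; apply/funext => m; apply: add0r. Qed.
Fact mps_addN : left_inverse mps_zero mps_opp mps_add.
Proof. by move=> F; apply/funext => m; apply: addNr. Qed.

HB.instance Definition _ := GRing.isZmodule.Build ps
  mps_addA mps_addC mps_add0 mps_addN.

Definition mps_trunc n F : {mpoly k[d]} :=
  \sum_(m : 'X_{1..d < n}) F m *: 'X_[m].

Lemma mps_truncE n F m : (mdeg m < n)%N -> (mps_trunc n F)@_m = F m.
Proof. exact: mcoeff_mpoly. Qed.

Lemma mps_mul_mpoly (p q : {mpoly k[d]}) F G m :
    (forall u, (mdeg u <= mdeg m)%N -> p@_u = F u) ->
    (forall u, (mdeg u <= mdeg m)%N -> q@_u = G u) ->
  mps_mul F G m = (p * q)@_m.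
Proof.
move=> pF qG; rewrite mcoeffM; apply: eq_bigr => u _.
by rewrite pF ?qG // -ltnS bmdeg.
Qed.

Lemma mps_mul_trunc n F G m : (mdeg m < n)%N ->
  mps_mul F G m = (mps_trunc n F * mps_trunc n G)@_m.
Proof.
by move=> mn; apply: mps_mul_mpoly => u um; rewrite mps_truncE //;
  apply: leq_ltn_trans mn.
Qed.

Fact mps_mulA : associative mps_mul.
Proof.
move=> F G H; apply/funext => m; pose T := mps_trunc (mdeg m).+1.
rewrite (@mps_mul_mpoly (T F) (T G * T H)) ?mulrA; first last.
- by move=> u um; rewrite (@mps_mul_trunc (mdeg m).+1).
- by move=> u um; rewrite mps_truncE.
apply/esym/mps_mul_mpoly => u um; last by rewrite mps_truncE.
by rewrite (@mps_mul_trunc (mdeg m).+1).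
Qed.
Fact mps_mulC : commutative mps_mul.
Proof.
by move=> F G; apply/funext => m; rewrite !(@mps_mul_trunc (mdeg m).+1) // mulrC.
Qed.
Fact mps_mul1 : left_id mps_one mps_mul.
Proof.
move=> F; apply/funext => m; pose T := mps_trunc (mdeg m).+1.
rewrite (@mps_mul_mpoly 1 (T F)) => [|u _|u um]; last by rewrite mps_truncE.
  by rewrite mul1r mps_truncE.
by rewrite mcoeff1.
Qed.
Fact mps_mulD : left_distributive mps_mul +%R.
Proof.
move=> F G H; apply/funext => m; rewrite /mps_mul /+%R /= /mps_add -big_split.
by apply: eq_bigr => u _; rewrite mulrDl.
Qed.
Fact mps_one_neq0 : mps_one != 0 :> ps.
Proof.
apply/eqP => /(congr1 (fun F : ps => F 0%MM)) /eqP.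
by rewrite /mps_one eqxx oner_eq0.
Qed.

HB.instance Definition _ := GRing.Zmodule_isComNzRing.Build ps
  mps_mulA mps_mulC mps_mul1 mps_mulD mps_one_neq0.

Fact mps_scaleA a b F : mps_scale a (mps_scale b F) = mps_scale (a * b) F.
Proof. by apply/funext => m; apply: mulrA. Qed.
Fact mps_scale1 : left_id 1 mps_scale.
Proof. by move=> F; apply/funext => m; apply: mul1r. Qed.
Fact mps_scaleDr : right_distributive mps_scale +%R.
Proof. by move=> a F G; apply/funext => m; apply: mulrDr. Qed.
Fact mps_scaleDl F : {morph mps_scale^~ F : a b / a + b}.
Proof. by move=> a b; apply/funext => m; apply: mulrDl. Qed.

HB.instance Definition _ := GRing.Zmodule_isLmodule.Build k ps
  mps_scaleA mps_scale1 mps_scaleDr mps_scaleDl.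

Fact mps_scaleAl (a : k) F G : a *: (F * G) = a *: F * G.
Proof.
apply/funext => m; rewrite [LHS]mulr_sumr.
by apply: eq_bigr => u _; apply: mulrA.
Qed.

HB.instance Definition _ := GRing.Lmodule_isLalgebra.Build k ps mps_scaleAl.
HB.instance Definition _ := GRing.Lalgebra_isComAlgebra.Build k ps.

End PowerSeries.

(* Main.v *)
(* Since k need not be perfect, replace k by its perfect closure K and let     *)
(* RK be K[x] or K[[x]]. With Tr the generator of the p^-1-linear maps on RK   *)
(* and phi = Tr (f^(p-1) * _), the ideals L_n = phi^n (RK) descend, and        *)
(* L_e = L_(e+1) gives, with q = p^(e+1), a q-th power linear operator on RK   *)
(* that maps f^(q-1) to f^(q-p). Composing it with a k-linear retraction       *)
(* K -> k applied to coefficients gives a differential operator on R that maps *)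
(* 1/f to 1/f^p; repeat with f^p, f^(p^2), ... in place of f.                  *)
(*   That L_n stabilises: if g L_n <= L_(n+1) then g L_(n+1) <= L_(n+2), and   *)
(* g^2 L_n <= phi (g^2 L_n), so g^2 L_n lies in all L_(n+j). For n large the   *)
(* ideal a of these g is constant. If a were proper, take a prime P minimal    *)
(* over the ideal carrying L_n into all L_(n+j); it contains a, but a finite   *)
(* length argument at P gives some h outside P with h L_m <= L_(m+1), m >= n.  *)

(* It suffices to find, for each power g = f^(p^i), an operator sending 1/g to 1/g^p: repeating this
   reaches every 1/f^(p^i), and each fraction is an R-multiple of one of these
   ([localization_generated]). With q = p^e, an operator that commutes with multiplication by g^q
   acts on fractions with denominator g^q through their numerators, so it does this as soon as it
   maps g^(q-1) to g^(q-p) ([diffop_lower_pole]).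

   Over a perfect field, f^(p^n-1) lies in the ideal generated by the p^n-th powers of elements of
   L_n. Taking p-th powers and rewriting elements of L_n as elements of L_(n+1) yields the operator
   on RK ([Frobenius_operator], [Cartier_trace]). That L_n = L_(n+1) for some n is [chain_stable],
   which uses only that RK is noetherian; this covers series, where no degree bounds the L_n.
   Noetherianity comes from [Dickson].

   The operator induced on R is differential because in characteristic p the q-fold commutator with
   x_i is the commutator with x_i^q, which vanishes, while R is generated by the x_i and by elements
   that become q-th powers in RK ([iter_commr_op_pchar], [pth_power_generated],
   [is_diffop_generated]). *)
From HB Require Import structures.
Require Import Defs.
From mathcomp Require Import all_boot all_order all_algebra generic_quotient.
From mathcomp Require Import mpoly boolp.
From mathcomp Require classical_sets.
From mathcomp Require Import ring.

Set Implicit Arguments.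
Unset Strict Implicit.
Unset Printing Implicit Defensive.

Import Order.TTheory GRing.Theory.
Local Open Scope ring_scope.

(** * Stabilisation of descending chains of ideals *)

Section Noetherian.
Variable R : comNzRingType.
Implicit Types I J N : R -> Prop.

Definition is_ideal I :=
  [/\ I 0, forall x y, I x -> I y -> I (x + y) & forall r x, I x -> I (r * x)].

Definition noetherian := forall F : (R -> Prop) -> Prop,
  (forall I, F I -> is_ideal I) -> (exists I, F I) ->
  exists I, F I /\
    forall J, F J -> (forall x, I x -> J x) -> forall x, J x -> I x.

Lemma ideal_colon I m : is_ideal I -> is_ideal (fun x => I (x * m)).
Proof.
case=> I0 ID IM; split=> [|x y Ix Iy|r x Ix]; first by rewrite mul0r.
  by rewrite mulrDl; apply: ID.
by rewrite -mulrA; apply: IM.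
Qed.

Lemma ideal_add_principal I J m : is_ideal I -> is_ideal J ->
  is_ideal (fun y => exists a z r, [/\ I a, J z & y = a + z + r * m]).
Proof.
case=> I0 ID IM [J0 JD JM]; split.
- by exists 0, 0, 0; split=> //; rewrite mul0r !addr0.
- move=> _ _ [a [z [r [Ia Jz ->]]]] [b [w [s [Ib Jw ->]]]].
  exists (a + b), (z + w), (r + s); split; [exact: ID|exact: JD|ring].
move=> t _ [a [z [r [Ia Jz ->]]]]; exists (t * a), (t * z), (t * r).
split; [exact: IM|exact: JM|ring].
Qed.

Hypothesis noethR : noetherian.

(* P is the radical of a maximal (J : s) among the s not nilpotent modulo J.  *)
Lemma minimal_prime J : is_ideal J -> ~ J 1 -> exists P : R -> Prop,
  [/\ forall x, J x -> P x, ~ P 1, forall x y, P (x * y) -> P x \/ P y,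
      forall r x, P x -> P (r * x) &
      exists2 s, ~ P s & forall x, P x -> exists j, J (s * x ^+ j)].
Proof.
move=> Jid J1; have [J0 JD JM] := Jid.
pose F I := exists s, (forall n, ~ J (s ^+ n)) /\ I = (fun x => J (s * x)).
have [||_ [[s [sN ->]] smax]] := noethR (F := F).
- move=> _ [s [_ ->]]; have := ideal_colon s Jid; congr is_ideal.
  by apply/funext => x; rewrite mulrC.
- by exists (fun x => J (1 * x)), 1; split=> // n; rewrite expr1n.
have key t y : (forall n, ~ J ((s * t) ^+ n)) -> J (s * t * y) -> J (s * y).
  move=> stN; apply: (smax (fun x => J (s * t * x))); first by exists (s * t).
  by move=> x Jx; rewrite mulrAC mulrC; apply: JM.
pose P x := exists n, J (s * x ^+ n).
have PX x n : P (x ^+ n) -> P x by case=> m; rewrite -exprM => H; exists (n * m)%N.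
have nilP x : ~ P x -> forall n, ~ J ((s * x) ^+ n).
  move=> NPx [|n]; first by rewrite expr0.
  rewrite exprMn exprS -mulrA mulrC => H; apply: NPx; exists n.+1.
  apply: (key (s ^+ n)); first by move=> m; rewrite -exprS -exprM.
  by rewrite -mulrA; move: H; rewrite mulrC.
exists P; split.
- by move=> x Jx; exists 1%N; rewrite expr1; apply: JM.
- by case=> n; rewrite expr1n mulr1; have := sN 1%N; rewrite expr1.
- move=> x y [n]; rewrite exprMn mulrA => H.
  have [Px|NPx] := pselect (P x); [by left | right; exists n].
  by apply: (key (x ^+ n)) H; apply: nilP => /PX.
- by move=> r x [n H]; exists n; rewrite exprMn mulrCA; apply: JM.
exists s => // -[n]; rewrite -exprS; exact: sN.
Qed.

(* The localisation at P of a module killed by a power of P has finite        *)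
(* length, so descending chains stabilise up to multiplication by h notin P.  *)
Lemma chain_generic_stable (P : R -> Prop) N (M : nat -> R -> Prop) :
    ~ P 1 -> (forall x y, P (x * y) -> P x \/ P y) ->
    (forall r x, P x -> P (r * x)) -> is_ideal N ->
    (forall n, is_ideal (M n)) -> (forall n x, M n.+1 x -> M n x) ->
    (forall n x, N x -> M n x) ->
    (forall x, P x -> exists s j, ~ P s /\ forall m, M 0 m -> N (s * x ^+ j * m)) ->
  exists n h, ~ P h /\ forall m, M n m -> M n.+1 (h * m).
Proof.
move=> P1 Pp PM Nid Mid Mdec NM nilM; apply: contrapT => Mbad.
have NPm s t : ~ P s -> ~ P t -> ~ P (s * t) by move=> Ps Pt /Pp[].
(* Noetherian induction: N is taken maximal among all counterexamples, the chain M varying with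
   it. *)
pose bad N (M : nat -> R -> Prop) :=
  [/\ is_ideal N, forall n, is_ideal (M n),
      (forall n x, M n.+1 x -> M n x) /\ (forall n x, N x -> M n x),
      forall x, P x -> exists s j, ~ P s /\ forall m, M 0 m -> N (s * x ^+ j * m)
      & ~ exists n h, ~ P h /\ forall m, M n m -> M n.+1 (h * m)].
have [||{}N [[{}M [{}Nid {}Mid [{}Mdec {}NM] {}nilM {}Mbad]] Nmax]] :=
  noethR (F := fun N => exists M, bad N M).
- by move=> I [? []].
- by exists N, M.
have [N0 ND NMu] := Nid.
(* Otherwise each element of M 0 is killed modulo N by something outside P; by noetherianity one s
   kills all of M 0, and this s already stabilises the chain. *)
have [m [Mm NmP]] : exists m, M 0 m /\ forall s, N (s * m) -> P s.
  apply: contrapT => noM.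
  have tors m : M 0 m -> exists s, ~ P s /\ N (s * m).
    move=> Mm; apply: contrapT => nos; apply: noM; exists m; split=> // s Ns.
    by apply: contrapT => Ps; apply: nos; exists s.
  pose F I := [/\ is_ideal I, forall x, I x -> M 0 x &
                  exists s, ~ P s /\ forall x, I x -> N (s * x)].
  have [||I [[Iid IM [s [Ps sI]]] Imax]] := noethR (F := F).
  - by move=> I [].
  - by exists N; split=> //; [exact: NM | exists 1; split=> // x; rewrite mul1r].
  apply: Mbad; exists 0, s; split=> // m Mm; apply/NM/sI.
  have [t [Pt tm]] := tors m Mm; have [M0 MD MM] := Mid 0.
  apply: (Imax (fun y => exists a z r, [/\ I a, I z & y = a + z + r * m])).
  - split; first exact: ideal_add_principal.
      move=> _ [a [z [r [Ia Iz ->]]]].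
      by apply: (MD); [apply: (MD); exact: IM | exact: MM].
    exists (s * t); split=> [|_ [a [z [r [Ia Iz ->]]]]]; first exact: NPm.
    have -> : s * t * (a + z + r * m) = t * (s * a) + t * (s * z) + r * s * (t * m).
      by ring.
    by apply: (ND); [apply: (ND); apply/NMu/sI | apply: NMu].
  - move=> x Ix; exists x, 0, 0; split=> //; last by rewrite mul0r !addr0.
    by case: Iid.
  - by exists 0, 0, 1; rewrite !add0r mul1r; case: Iid.
(* P is an associated prime: a maximal (N : m) among those contained in P equals P. For x in P some
   t x^j m is in N with t outside P, and maximality brings this down to x m in N. *)
have {m Mm NmP} [m [Mm NmP PmN]] : exists m,
    [/\ M 0 m, forall s, N (s * m) -> P s & forall x, P x -> N (x * m)].
  pose F I := exists m, [/\ M 0 m, forall s, N (s * m) -> P s &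
                            I = fun s => N (s * m)].
  have [||_ [{m Mm NmP} [m [Mm NmP ->]] mmax]] := noethR (F := F).
  - by move=> _ [m' [_ _ ->]]; apply: ideal_colon.
  - by exists (fun s => N (s * m)), m.
  have {}mmax r : (forall s, N (s * r * m) -> P s) ->
      forall s, N (s * r * m) -> N (s * m).
    move=> rP s; apply: (mmax (fun s => N (s * r * m))) => [|u Nu]; last first.
      by rewrite mulrAC mulrC; apply: NMu.
    exists (r * m); split=> [|u|]; first by have [_ _] := Mid 0; apply.
      by rewrite mulrA; apply: rP.
    by apply/funext => u; rewrite mulrA.
  exists m; split=> // x Px; have [s [j [Ps sx]]] := nilM x Px.
  have {sx} [t [Pt tN]] : exists t, ~ P t /\ N (t * x ^+ j * m).
    by exists s; split=> //; apply: sx.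
  elim: j t Pt tN => [|j IHj] t Pt tN.
    by exfalso; apply: Pt; apply: NmP; move: tN; rewrite mulr1.
  have [[u [Pu uN]]|nou] := pselect (exists t, ~ P t /\ N (t * x ^+ j * m)).
    exact: IHj uN.
  have xjP s' : N (s' * x ^+ j * m) -> P s'.
    by move=> H; apply: contrapT => H'; apply: nou; exists s'.
  have txm : N (t * x * m) by apply: (mmax (x ^+ j) xjP); rewrite -(mulrA t) -exprS.
  apply: (mmax t); last by rewrite (mulrC x).
  by move=> u /NmP /Pp[].
(* N' = N + R m is strictly larger than N, so the chain M + N' satisfies the conclusion. It remains
   to absorb R m. *)
pose N' y := exists a z r, [/\ N a, N z & y = a + z + r * m].
have N'id : is_ideal N' by exact: ideal_add_principal.
have NN' x : N x -> N' x.
  by move=> Nx; exists x, 0, 0; split=> //; rewrite mul0r !addr0.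
have N'M x : N' x -> M 0 x.
  have [M0 MD MM] := Mid 0; move=> [a [z [r [Na Nz ->]]]].
  by apply: (MD); [apply: (MD); exact: NM | exact: MM].
pose MN n1 n y := exists a z r, [/\ M (n1 + n)%N a, N z & y = a + z + r * m].
have main n1 : exists n h, ~ P h /\ forall x, M (n1 + n)%N x -> MN n1 n.+1 (h * x).
  apply: contrapT => nomain.
  suff /NmP/P1 : N (1 * m) by [].
  rewrite mul1r; apply: (Nmax N') => //.
    exists (MN n1); split=> //.
    - by move=> n; apply: ideal_add_principal.
    - split=> n x [a [z [r [Ma Nz ->]]]]; exists a, z, r; split=> //.
        by apply: Mdec; rewrite -addnS.
      exact: NM.
    - move=> x Px; have [s [j [Ps sN]]] := nilM x Px; exists s, j; split=> // y.
      move=> [a [z [r [Ma Nz ->]]]]; apply/NN'/sN.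
      have [M0 MD MM] := Mid 0; apply: (MD); last exact: MM.
      apply: MD; last exact: NM.
      by elim: (n1 + 0)%N Ma => // i IHi /Mdec.
    move=> [n [h [Ph hM]]]; apply: nomain; exists n, h; split=> // x Mx.
    by apply: hM; exists x, 0, 0; split=> //; rewrite mul0r !addr0.
  by exists 0, 0, 1; rewrite !add0r mul1r.
(* Up to factors outside P, R m modulo N is like the residue field of P: either some M n1 meets R m
   only in N, or every M n contains some r m with r outside P. *)
have [[n1 n1P]|non1] := pselect (exists n1, forall r, M n1 (r * m) -> P r).
  have [n [h [Ph hM]]] := main n1; apply: Mbad; exists (n1 + n)%N, h.
  split=> // x Mx; have [a [z [r [Ma Nz e]]]] := hM x Mx.
  have [_ MD MM] := Mid (n1 + n)%N; have [_ MD' _] := Mid (n1 + n).+1.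
  suff Nr : N (r * m).
    by rewrite e; apply: (MD'); [apply: (MD'); [rewrite -addnS|exact: NM]|exact: NM].
  apply/PmN/n1P; suff : M (n1 + n)%N (r * m).
    by elim: (n) => [|i IHi]; rewrite ?addn0 // addnS => /Mdec.
  have -> : r * m = h * x + (-1 * a + -1 * z) by rewrite e; ring.
  apply: (MD); [exact: MM | apply: (MD); apply: (MM)]; last exact: NM.
  by apply: Mdec; rewrite -addnS.
have [n [h [Ph hM]]] := main 0.
have [r [Pr Mr]] : exists r, ~ P r /\ M n.+1 (r * m).
  apply: contrapT => nor; apply: non1; exists n.+1 => r Mr.
  by apply: contrapT => Pr; apply: nor; exists r.
apply: Mbad; exists n, (r * h); split=> [|x Mx]; first exact: NPm.
have [a [z [t [Ma Nz e]]]] := hM x Mx; have [_ MD MM] := Mid n.+1.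
rewrite -mulrA e (_ : _ * _ = r * a + r * z + t * (r * m)); last by ring.
by apply: (MD); [apply: (MD); apply: (MM) => //; exact: NM | exact: MM].
Qed.

(** The last hypothesis says that the colon ideals (L n.+1 : L n) grow with n and that squares of
    their elements carry L n into all later terms. Once these ideals are constant, the h found at a
    prime P over J lies in (L n.+1 : L n), so its square lies in J, hence in P. *)
Theorem chain_stable (L : nat -> R -> Prop) :
    (forall n, is_ideal (L n)) -> (forall n x, L n.+1 x -> L n x) ->
    (forall n g, (forall x, L n x -> L n.+1 (g * x)) ->
       (forall x, L n.+1 x -> L n.+2 (g * x)) /\
       (forall j x, L n x -> L (n + j)%N (g ^+ 2 * x))) ->
  exists n, forall x, L n x -> L n.+1 x.
Proof.
move=> Lid Ldec Lg; pose a n g := forall x, L n x -> L n.+1 (g * x).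
have aid n : is_ideal (a n).
  have [L0 LD LM] := Lid n.+1; split=> [x _|g h ag ah x Lx|r g ag x Lx].
  - by rewrite mul0r.
  - by rewrite mulrDl; apply: (LD); [apply: ag | apply: ah].
  - by rewrite -mulrA; apply/LM/ag.
have [||_ [[n ->] nmax]] := noethR (F := fun I => exists n, I = a n).
- by move=> _ [n ->].
- by exists (a 0), 0.
have amax j g : a (n + j)%N g -> a n g.
  apply: nmax; first by exists (n + j)%N.
  by move=> {}g ag; elim: j => [|j /Lg[]]; rewrite ?addn0 // addnS.
have [a1|Na1] := pselect (a n 1).
  by exists n => x /a1; rewrite mul1r.
pose J g := forall j x, L n x -> L (n + j)%N (g * x).
have Jid : is_ideal J.
  split=> [j x _|g h Jg Jh j x Lx|r g Jg j x Lx]; have [L0 LD LM] := Lid (n + j)%N.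
  - by rewrite mul0r.
  - by rewrite mulrDl; apply: (LD); [apply: Jg | apply: Jh].
  - by rewrite -mulrA; apply/LM/Jg.
have [|P [JP P1 Pp PM [s Ps sP]]] := minimal_prime Jid.
  by move=> J1; apply: Na1 => x /(J1 1%N); rewrite addn1.
have LnD j x : L (n + j)%N x -> L n x.
  by elim: j => [|j IHj]; rewrite ?addn0 // addnS => /Ldec.
pose N x := forall j, L (n + j)%N x.
have [|||||j [h [Ph hL]]] :=
  @chain_generic_stable P N (fun j => L (n + j)%N) P1 Pp PM.
- split=> [j|x y Nx Ny j|r x Nx j]; have [L0 LD LM] := Lid (n + j)%N => //.
    by apply: (LD); [apply: Nx | apply: Ny].
  exact/LM/Nx.
- by move=> j.
- by move=> j x; rewrite addnS; apply: Ldec.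
- by move=> j x; apply.
- move=> x /sP[j Jx]; exists s, j; split=> // m; rewrite addn0 => Lm i.
  exact: Jx.
suff : P (h ^+ 2) by rewrite expr2 => /Pp[].
apply: JP => i x; apply: (Lg n h _).2.
by apply: (amax j) => {}x; rewrite -addnS; apply: hL.
Qed.

End Noetherian.

(** * Cartier maps *)

Section Frobenius.
Variables (R : comNzRingType) (p : nat).
Hypothesis charRp : p \in [pchar R].

Lemma pchar_expD e (x y : R) : (x + y) ^+ (p ^ e) = x ^+ (p ^ e) + y ^+ (p ^ e).
Proof.
elim: e => [|e IHe]; first by rewrite !expr1.
by rewrite expnSr !exprM IHe -!(pFrobenius_autE charRp) rmorphD.
Qed.

Lemma pchar_exp_sum e (T : Type) (s : seq T) (E : T -> R) :
  (\sum_(t <- s) E t) ^+ (p ^ e) = \sum_(t <- s) E t ^+ (p ^ e).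
Proof.
have p_gt0 : (0 < p)%N by apply/prime_gt0/(pcharf_prime charRp).
elim: s => [|t s IHs]; last by rewrite !big_cons pchar_expD IHs.
by rewrite !big_nil expr0n expn_eq0 eqn0Ngt p_gt0.
Qed.

End Frobenius.

Lemma pchar_exp_inj (R : idomainType) (p e : nat) : p \in [pchar R] ->
  injective (fun x : R => x ^+ (p ^ e)).
Proof.
move=> charRp x y /= exy; apply/eqP; rewrite -subr_eq0.
suff : (x - y) ^+ (p ^ e) == 0 by rewrite expf_eq0 => /andP[].
have := pchar_expD charRp e (x - y) y.
by rewrite subrK exy -{1}[y ^+ _]add0r => /addIr <-.
Qed.

Section CartierMap.
Variables (R : comNzRingType) (p : nat) (Tr : R -> R).
Hypotheses (charRp : p \in [pchar R]) (noethR : noetherian R).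
Hypothesis TrD : {morph Tr : x y / x + y}.
Hypothesis TrM : forall r x, Tr (r ^+ p * x) = r * Tr x.
(** That is, h lies in the ideal generated by the p-th powers of the Tr (g * h). In the rings
    considered this reflects that RK is free over its p-th powers with Tr generating the dual. *)
Hypothesis Tr_generates : forall h, exists s : seq (R * R),
  h = \sum_(i <- s) i.1 * Tr (i.2 * h) ^+ p.

Let p_gt1 : (1 < p)%N := prime_gt1 (pcharf_prime charRp).
Let p_gt0 : (0 < p)%N := ltnW p_gt1.

Lemma iter_TrM e r x : iter e Tr (r ^+ (p ^ e) * x) = r * iter e Tr x.
Proof.
elim: e r => [|e IHe] r /=; first by rewrite expr1.
by rewrite expnS exprM IHe TrM.
Qed.

Lemma iter_TrD e : {morph iter e Tr : x y / x + y}.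
Proof. by elim: e => [|e IHe] x y //=; rewrite IHe TrD. Qed.

(** Expand each Tr^e (b h) by [Tr_generates] and move the new multipliers inside the iterate as
    p^e-th powers. *)
Lemma iter_Tr_generates e h : exists s : seq (R * R),
  h = \sum_(i <- s) i.1 * iter e Tr (i.2 * h) ^+ (p ^ e).
Proof.
elim: e => [|e [s hs]].
  by exists [:: (1, 1)]; rewrite big_seq1 expr1 !mul1r.
pose good x := exists s : seq (R * R),
  x = \sum_(i <- s) i.1 * iter e.+1 Tr (i.2 * h) ^+ (p ^ e.+1).
have goodD x y : good x -> good y -> good (x + y).
  by move=> [u ->] [v ->]; exists (u ++ v); rewrite big_cat.
rewrite -/(good h) {1}hs; apply: (big_ind good) => //.
  by exists [::]; rewrite big_nil.
move=> [a b] _ /=; have [t ht] := Tr_generates (iter e Tr (b * h)).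
rewrite {1}ht (pchar_exp_sum charRp) mulr_sumr; apply: (big_ind good) => //.
  by exists [::]; rewrite big_nil.
move=> [c g] _ /=; exists [:: (a * c ^+ (p ^ e), g ^+ (p ^ e) * b)].
by rewrite big_seq1 /= exprMn -exprM -expnS -!mulrA iter_TrM.
Qed.

(** If L n = L n.+1, write f^(p^n-1) as the sum of a_i Tr^n(b_i f^(p^n-1))^(p^n), replace each trace
    by Tr^(n+1)(b_i' f^(p^(n+1)-1)) and take p-th powers. This dictates D x = sum of a_i^p
    Tr^(n+1)(b_i' x)^(p^(n+1)). *)
Theorem Frobenius_operator f : exists e (D : R -> R),
  [/\ (0 < e)%N, {morph D : x y / x + y},
      forall r x, D (r ^+ (p ^ e) * x) = r ^+ (p ^ e) * D x &
      D (f ^+ (p ^ e - 1)) = f ^+ (p ^ e - p)].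
Proof.
pose phi x := Tr (f ^+ (p - 1) * x).
have phiM r x : phi (r ^+ p * x) = r * phi x by rewrite /phi mulrCA TrM.
(* The exponents add up to (p-1)(1 + p + ... + p^(e-1)) = p^e - 1. *)
have phiE e x : iter e phi x = iter e Tr (f ^+ (p ^ e - 1) * x).
  elim: e => [|e IHe] /=; first by rewrite mul1r.
  rewrite IHe /phi -iter_TrM mulrA -exprM -exprD; congr (Tr (iter e Tr (_ * x))).
  have q_gt0 : (0 < p ^ e)%N by rewrite expn_gt0 p_gt0.
  by congr (f ^+ _); rewrite expnS mulnBl mul1n addnBA // subnK // leq_pmull.
pose L n x := exists y, x = iter n phi y.
have phiD : {morph phi : x y / x + y} by move=> x y; rewrite /phi mulrDr TrD.
have iphiD n : {morph iter n phi : x y / x + y}.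
  by elim: n => [|n IHn] x y //=; rewrite IHn phiD.
have iphiM n r x : iter n phi (r ^+ (p ^ n) * x) = r * iter n phi x.
  by rewrite !phiE mulrCA iter_TrM.
have Ldec n x : L n.+1 x -> L n x by move=> [y ->]; exists (phi y); rewrite iterSr.
have Lid n : is_ideal (L n).
  split.
  - by exists 0; have := iphiM n 0 0; rewrite mul0r mulr0.
  - by move=> _ _ [x ->] [y ->]; exists (x + y); rewrite iphiD.
  - by move=> r _ [x ->]; exists (r ^+ (p ^ n) * x); rewrite iphiM.
have [|n Ln] := chain_stable noethR Lid Ldec.
  (* Both claims rest on g phi(z) = phi(g^p z). For the first, g^p = g g^(p-1); for the second, g x
     = phi(z) with z in L n gives g^2 x = phi(g^2 (g^(p-2) z)), and this is iterated. *)
  move=> n g gL; split.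
    move=> _ [x ->] /=; rewrite -phiM -(subnKC p_gt0) exprD expr1 -mulrA.
    have [|y ->] := gL (g ^+ (p - 1) * iter n phi x); last by exists y.
    by have [_ _ LM] := Lid n; apply: LM; exists x.
  move=> j x Lx; suff [x' [[y ->] ->]] :
      exists x', L n x' /\ g ^+ 2 * x = iter j phi (g ^+ 2 * x').
    by exists ((g ^+ 2) ^+ (p ^ n) * y); rewrite addnC iterD iphiM.
  elim: j => [|j [x' [/gL [y ye] ->]]]; first by exists x.
  exists (g ^+ (p - 2) * iter n phi y); split.
    by have [_ _ LM] := Lid n; apply: LM; exists y.
  rewrite iterSr {1}expr2 -mulrA ye iterS -phiM mulrA -exprD.
  by rewrite subnKC.
have [s hs] := iter_Tr_generates n (f ^+ (p ^ n - 1)).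
have /boolp.choice[r' r'P] r : exists r', iter n Tr (r * f ^+ (p ^ n - 1)) =
    iter n.+1 Tr (r' * f ^+ (p ^ n.+1 - 1)).
  have [|y] := Ln (iter n phi r); first by exists r.
  by rewrite !phiE => e; exists y; rewrite mulrC e mulrC.
exists n.+1, (fun x => \sum_(i <- s) i.1 ^+ p *
  iter n.+1 Tr (r' i.2 * x) ^+ (p ^ n.+1)); split=> //.
- move=> x y; rewrite -big_split; apply: eq_bigr => i _ /=.
  by rewrite -mulrDr -(pchar_expD charRp) -TrD -iter_TrD -mulrDr.
- move=> r x; rewrite mulr_sumr; apply: eq_bigr => i _ /=.
  rewrite [in RHS]mulrCA -exprMn -(iter_TrM n.+1 r).
  by rewrite /= (mulrCA (r' i.2)).
have -> : (p ^ n.+1 - p = (p ^ n - 1) * p)%N by rewrite mulnBl mul1n -expnSr.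
rewrite [RHS]exprM {1}hs -[p in RHS]expn1 (pchar_exp_sum charRp).
apply: eq_bigr => i _; rewrite -r'P expn1 exprMn -exprM; congr (_ * _ ^+ _).
by rewrite expnSr.
Qed.

End CartierMap.

(** * Operators linear over a large subring *)

Section NilpotentCommutators.
Variables (R : comNzRingType) (d : nat) (x : 'I_d -> R) (S : R -> Prop).

Inductive generated : R -> Prop :=
  | GeneratedBase r : S r -> generated r
  | GeneratedVar i : generated (x i)
  | GeneratedD r s : generated r -> generated s -> generated (r + s)
  | GeneratedM r s : generated r -> generated s -> generated (r * s).

Implicit Types h : R -> R.

Lemma is_diffop0 n : is_diffop n (fun _ : R => 0).
Proof.
by apply: (@is_diffop_leq _ 0) => //; exists 0; apply/funext => y; rewrite mul0r.
Qed.

Lemma commr_op0 n y : iter n (@commr_op R ^~ y) (fun=> 0) = fun=> 0.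
Proof.
by elim: n => //= n ->; apply/funext => z; rewrite /commr_op mulr0 subr0.
Qed.

Lemma commr_opC h y z : commr_op (commr_op h y) z = commr_op (commr_op h z) y.
Proof. by apply/funext => t; rewrite /commr_op (mulrCA y); ring. Qed.

Lemma iter_commr_opC n h y z :
  iter n (@commr_op R ^~ y) (commr_op h z) = commr_op (iter n (@commr_op R ^~ y) h) z.
Proof. by elim: n => //= n ->; rewrite commr_opC. Qed.

(** A commutator with x i lowers n i by one, those with elements of S vanish, and those with sums
    and products expand into commutators with the constituents; hence induction on N. *)
Lemma is_diffop_generated N (n : 'I_d -> nat) h :
    (forall r, generated r) -> {morph h : y z / y + z} ->
    (forall r y, S r -> h (r * y) = r * h y) ->
    (forall i, iter (n i) (@commr_op R ^~ (x i)) h = fun=> 0) ->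
    (\sum_i n i <= N)%N ->
  is_diffop N h.
Proof.
move=> gen; elim: N n h => [|N IHN] n h hD hS hn nN.
  (* The zeroth iterate is h itself, so n i = 0 forces h = 0 as soon as there is a variable. *)
  have h0 (i : 'I_d) : h = fun=> 0.
    have := hn i; suff -> : n i = 0%N by [].
    by apply/eqP; rewrite -leqn0 (leq_trans _ nN) // (bigD1 i) //= leq_addr.
  suff hM y z : h (y * z) = y * h z.
    by exists (h 1); apply/funext => y; rewrite -[y in LHS]mulr1 hM mulrC.
  elim: (gen y) z => [r Sr|i|r s _ hr _ hs|r s _ hr _ hs] z.
  - exact: hS.
  - by rewrite (h0 i) mulr0.
  - by rewrite mulrDl hD hr hs mulrDl.
  - by rewrite -!mulrA hr hs.
split=> // r; elim: (gen r) => {r} [r Sr|i|r s _ hr _ hs|r s _ hr _ hs].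
- have -> : commr_op h r = fun=> 0; last exact: is_diffop0.
  by apply/funext => y; rewrite /commr_op hS // subrr.
- have [n0|ni] := posnP (n i).
    have := hn i; rewrite n0 /= => ->.
    have := commr_op0 1 (x i); rewrite /= => ->; exact: is_diffop0.
  apply: (IHN (fun j => n j - (j == i))%N) => [y z|s y Ss|j|].
  - by rewrite /commr_op mulrDr !hD; ring.
  - by rewrite /commr_op mulrCA !(hS s) //; ring.
  - have [->|_] := eqVneq j i; last first.
      by rewrite subn0 iter_commr_opC hn; apply: (commr_op0 1).
    by rewrite -iterSr subn1 prednK.
  rewrite -ltnS (leq_trans _ nN) // (bigD1 i) //= [X in (_ < X)%N](bigD1 i) //=.
  rewrite eqxx -addSn subn1 prednK // leq_add2l.
  by apply: leq_sum => j _; apply: leq_subr.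
- have -> : commr_op h (r + s) = fun y => commr_op h r y + commr_op h s y.
    by apply/funext => y; rewrite /commr_op mulrDl hD; ring.
  exact: is_diffopD.
have -> : commr_op h (r * s) = fun y => commr_op h r (s * y) + r * commr_op h s y.
  by apply/funext => y; rewrite /commr_op !mulrA; ring.
by apply: is_diffopD; [apply: is_diffopMr | apply: is_diffopMl].
Qed.

(** Composing h with multiplication by y on the right and on the left are commuting operations, and
    the commutator is their difference: this is the binomial theorem. *)
Lemma iter_commr_op_bin n h y : iter n (@commr_op R ^~ y) h =
  fun z => \sum_(i < n.+1) (-1) ^+ i * y ^+ i * h (y ^+ (n - i) * z) *+ 'C(n, i).
Proof.
elim: n => [|n IHn].
  by apply/funext => z; rewrite big_ord1 /= bin0 !mul1r.
rewrite iterS IHn; apply/funext => z; rewrite /commr_op.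
pose a i := (-1) ^+ i * y ^+ i * h (y ^+ (n.+1 - i) * z).
have -> : \sum_(i < n.+1) (-1) ^+ i * y ^+ i * h (y ^+ (n - i) * (y * z)) *+ 'C(n, i)
    = \sum_(i < n.+1) a i *+ 'C(n, i).
  apply: eq_bigr => i _; rewrite /a subSn; last by rewrite -ltnS.
  by rewrite [y ^+ _.+1]exprSr -!mulrA.
have -> : y * (\sum_(i < n.+1) (-1) ^+ i * y ^+ i * h (y ^+ (n - i) * z) *+ 'C(n, i))
    = - \sum_(i < n.+1) a i.+1 *+ 'C(n, i).
  rewrite mulr_sumr -sumrN; apply: eq_bigr => i _.
  by rewrite /a subSS -mulNrn mulrnAr !exprS; congr (_ *+ _); ring.
rewrite opprK [RHS]big_ord_recl [X in X + _]big_ord_recl !bin0 -addrA.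
congr (_ + _); rewrite /bump /=.
under [in RHS]eq_bigr => i _ do rewrite binS mulrnDr -/(a _).
rewrite big_split /= [X in _ = X + _]big_ord_recr /= bin_small // addr0.
by congr (_ + _); apply: eq_bigr => i _; rewrite add1n.
Qed.

(** The p-th power of a difference of commuting operations is the difference of the p-th powers in
    characteristic p. *)
Lemma iter_commr_op_pchar p e h y : p \in [pchar R] ->
  iter (p ^ e) (@commr_op R ^~ y) h = commr_op h (y ^+ (p ^ e)).
Proof.
move=> charRp; have p_pr := pcharf_prime charRp.
have p1 z g : iter p (@commr_op R ^~ z) g = commr_op g (z ^+ p).
  rewrite iter_commr_op_bin; apply/funext => t.
  rewrite big_ord_recl -(prednK (prime_gt0 p_pr)) big_ord_recr /= big1 => [|i _].
    rewrite /bump /= add1n (prednK (prime_gt0 p_pr)) add0r bin0 binn subnn subn0.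
    rewrite !mul1r -exprMn mulN1r /commr_op; congr (_ + _).
    (* Additivity of Frobenius gives (-y)^p = -y^p, for p = 2 as well. *)
    rewrite -(pFrobenius_autE charRp) rmorphN mulNr.
    by rewrite [_ _ z](pFrobenius_autE charRp).
  rewrite /bump /= add1n (prednK (prime_gt0 p_pr)).
  rewrite -mulr_natr -[_%:R]/(_%:R) (_ : 'C(_, _)%:R = 0) ?mulr0 //.
  apply/eqP; rewrite -(dvdn_pcharf charRp) prime_dvd_bin //=.
  by rewrite -ltn_predRL.
elim: e y => [|e IHe] y; first by rewrite expr1.
rewrite expnSr iterM (eq_iter (fun g => p1 y g)) IHe -exprM.
by rewrite mulnC.
Qed.

End NilpotentCommutators.

(** * Descent of the operator from RK to R *)

Section Descent.
Variables (k : comNzRingType) (R : comAlgType k) (RK : comNzRingType) (p : nat).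
Variables (iota : {rmorphism R -> RK}) (rho : RK -> R) (Tr : RK -> RK).
Variables (d : nat) (x : 'I_d -> R).
Hypotheses (charR : p \in [pchar R]) (charRK : p \in [pchar RK]).
Hypothesis rhoD : {morph rho : y z / y + z}.
Hypothesis rhoM : forall r y, rho (iota r * y) = r * rho y.
Hypothesis rho1 : rho 1 = 1.
Hypothesis noethRK : noetherian RK.
Hypothesis TrD : {morph Tr : y z / y + z}.
Hypothesis TrM : forall r y, Tr (r ^+ p * y) = r * Tr y.
Hypothesis Tr_generates : forall h, exists s : seq (RK * RK),
  h = \sum_(i <- s) i.1 * Tr (i.2 * h) ^+ p.
Hypothesis scalar_root : forall e (a : k), exists y, iota (a%:A) = y ^+ (p ^ e).
Hypothesis gen : forall e r,
  generated x (fun m => exists y, iota m = y ^+ (p ^ e)) r.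

(** The operator is [rho] after D after [iota]. It is linear over every element of R that becomes a
    q-th power in RK: scalars, which gives k-linearity; f^q; and the x_i^q, which kills the q-fold
    commutators with x_i. *)
Lemma diffop_lower_pole f : exists e (u : diffop R),
  [/\ (0 < e)%N, forall y, u (f ^+ (p ^ e) * y) = f ^+ (p ^ e) * u y &
      u (f ^+ (p ^ e - 1)) = f ^+ (p ^ e - p)].
Proof.
have [e [D [e_gt0 DD DM Df]]] :=
  Frobenius_operator charRK noethRK TrD TrM Tr_generates (iota f).
pose h r := rho (D (iota r)).
have hD : {morph h : y z / y + z} by move=> y z; rewrite /h rmorphD DD rhoD.
have hS m y : (exists z, iota m = z ^+ (p ^ e)) -> h (m * y) = m * h y.
  by move=> [z ez]; rewrite /h rmorphM ez DM -ez rhoM.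
have h_scal (a : k) y : h (a *: y) = a *: h y.
  by rewrite -mulr_algl hS ?mulr_algl //; apply: scalar_root.
have h_diffop : is_diffop (\sum_(i < d) p ^ e) h.
  apply: (is_diffop_generated (gen e) hD (n := fun=> p ^ e)%N) => // i.
  rewrite (iter_commr_op_pchar _ _ _ charR); apply/funext => y.
  rewrite /commr_op hS ?subrr //; exists (iota (x i)); exact: rmorphXn.
have h_order : exists n, is_diffop n h by exists (\sum_(i < d) p ^ e)%N.
exists e, (Diffop h_scal h_order); split=> //= [y|].
  by rewrite hS //; exists (iota f); rewrite rmorphXn.
by rewrite /h rmorphXn Df -rmorphXn -[iota _]mulr1 rhoM rho1 mulr1.
Qed.

Theorem localization_generated (f : R) (y : localization f) :
  exists u : diffop R, y = u *: locfrac f 1 1.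
Proof.
have p_gt0 : (0 < p)%N by apply/prime_gt0/(pcharf_prime charR).
have step i : exists u : diffop R,
    u *: locfrac f 1 (p ^ i) = locfrac f 1 (p ^ i.+1).
  have [e [u [e_gt0 ulin uf]]] := diffop_lower_pole (f ^+ (p ^ i)).
  have q_gt0 : (0 < p ^ e)%N by rewrite expn_gt0 p_gt0.
  set g := f ^+ (p ^ i) in ulin uf; exists u.
  have comm : u * diffop_mul (g ^+ (p ^ e)) = diffop_mul (g ^+ (p ^ e)) * u.
    by apply: diffop_eq => z; rewrite !diffopM /= ulin.
  (* As u commutes with g^q, which is invertible in R_f, numerators decide: 1/g = g^(q-1)/g^q goes
     to g^(q-p)/g^q = 1/g^p. *)
  apply: (@loc_lreg _ _ (p ^ i * p ^ e)%N); rewrite exprM -/g.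
  rewrite -loc_scale_mul scalerA -comm -scalerA loc_scale_mul.
  have gq n : (n <= p ^ e)%N ->
      loc_inj f (g ^+ (p ^ e)) * locfrac f 1 (p ^ i * n) = loc_inj f (g ^+ (p ^ e - n)).
    move=> nq; rewrite -{1}(subnK nq) exprD rmorphM -mulrA -[g ^+ n]exprM.
    by rewrite locfracK rmorph1 mulr1.
  have := gq 1%N q_gt0; rewrite muln1 => ->.
  rewrite loc_inj_linear uf expnSr gq //.
  by rewrite -{1}(expn1 p) leq_pexp2l.
have [a [m ->]] := locfracW y.
have [i mi] : exists i, (m <= p ^ i)%N.
  by exists m; apply/ltnW/ltn_expl/prime_gt1/(pcharf_prime charR).
have [u ui] : exists u : diffop R, u *: locfrac f 1 1 = locfrac f 1 (p ^ i).
  elim: i {mi} => [|i [u ui]]; first by exists 1; rewrite scale1r.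
  by have [v vi] := step i; exists (v * u); rewrite -scalerA ui vi.
exists (diffop_mul (a * f ^+ (p ^ i - m)) * u).
rewrite -scalerA ui loc_scale_mul /loc_inj locfracM; apply: locfrac_eq.
by rewrite add0n mulr1 mulrCA -exprD subnKC // mulrC.
Qed.

End Descent.

(** * Noetherianity of polynomials and power series *)

Section Dickson.
Variable d : nat.
Local Open Scope nat_scope.

(** Repeatedly choose an index where u is minimal on the remaining tail. *)
Lemma nondecreasing_subseq (u : nat -> nat) : exists phi : nat -> nat,
  (forall i j, i < j -> phi i < phi j) /\
  (forall i j, i <= j -> u (phi i) <= u (phi j)).
Proof.
have next N : exists n, N <= n /\ forall n', N <= n' -> u n <= u n'.
  have exP : exists v, `[< exists2 n, N <= n & u n = v >].
    by exists (u N); apply/asboolP; exists N.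
  case: (ex_minnP exP) => v /asboolP[n0 Nn0 <-] vmin.
  by exists n0; split=> // n' Nn'; apply: vmin; apply/asboolP; exists n'.
have [nx nxP] := boolp.choice next.
pose phi := fix phi i := if i is i'.+1 then nx (phi i').+1 else nx 0.
have phiS i : phi i < phi i.+1 by have [] := nxP (phi i).+1.
have phi_lt i j : i < j -> phi i < phi j.
  elim: j => // j IHj; rewrite ltnS leq_eqVlt => /predU1P[->//|/IHj].
  by move=> /ltn_trans; apply.
exists phi; split=> // i j; rewrite leq_eqVlt => /predU1P[->//|ij].
case: i ij => [|i] ij; first by apply: (nxP 0).2.
by apply: (nxP (phi i).+1).2; apply/phi_lt/ltnW.
Qed.

(** Pass to a subsequence once per coordinate, making one more coordinate nondecreasing each
    time. *)
Lemma Dickson (m : nat -> 'X_{1..d}) : exists i j, i < j /\ (m i <= m j)%MM.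
Proof.
suff /(_ d)[phi [phi_lt phi_le]] : forall e, exists phi : nat -> nat,
    (forall i j, i < j -> phi i < phi j) /\
    forall c : 'I_d, c < e -> forall i j, i <= j -> m (phi i) c <= m (phi j) c.
  exists (phi 0), (phi 1); split; first exact: phi_lt.
  by apply/mnm_lepP => c; apply: phi_le.
elim=> [|e [phi [phi_lt phi_le]]]; first by exists id; split.
have [ed|de] := ltnP e d; last first.
  exists phi; split=> // c _; apply: phi_le; exact: leq_trans (ltn_ord c) de.
have [psi [psi_lt psi_le]] := nondecreasing_subseq (fun i => m (phi i) (Ordinal ed)).
exists (phi \o psi); split=> [i j ij|c]; first exact/phi_lt/psi_lt.
rewrite ltnS leq_eqVlt => /predU1P[ce|ce] i j ij.
  by have := psi_le _ _ ij; congr (m _ _ <= m _ _); apply: val_inj.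
apply: phi_le => //; move: ij; rewrite leq_eqVlt => /predU1P[->//|ij].
exact/ltnW/psi_lt.
Qed.

(** Otherwise one could forever add elements of E not above any earlier one, against [Dickson]. *)
Lemma finite_monomial_basis (E : 'X_{1..d} -> Prop) : exists s : seq 'X_{1..d},
  (forall m, m \in s -> E m) /\ (forall m, E m -> exists2 l, l \in s & (l <= m)%MM).
Proof.
apply: contrapT => Enot.
have next (s : seq 'X_{1..d}) : exists m, (forall l, l \in s -> E l) ->
    E m /\ forall l, l \in s -> ~~ (l <= m)%MM.
  have [sE|NsE] := pselect (forall l, l \in s -> E l); last by exists 0%MM => /NsE.
  apply: contrapT => nom; apply: Enot; exists s; split=> // m Em.
  apply: contrapT => nol; apply: nom; exists m => _; split=> // l ls.
  by apply/negP => lm; apply: nol; exists l.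
have [nx nxP] := boolp.choice next.
pose s := fix s i := if i is i'.+1 then nx (s i') :: s i' else [::].
have sE i l : l \in s i -> E l.
  elim: i l => //= i IHi l; rewrite inE => /predU1P[->|/IHi//].
  exact: (nxP (s i) IHi).1.
have mem i j : i < j -> nx (s i) \in s j.
  elim: j => //= j IHj; rewrite ltnS inE leq_eqVlt => /predU1P[->|/IHj->].
    by rewrite eqxx.
  by rewrite orbT.
have [i [j [ij]]] := Dickson (nx \o s).
by apply/negP/((nxP (s j) (sE j)).2)/mem.
Qed.

End Dickson.

(* E I stands for the set of leading exponents of the ideal I.               *)
Lemma noetherian_exponents (R : comNzRingType) (d : nat)
    (E : (R -> Prop) -> 'X_{1..d} -> Prop) :
    (forall I J : R -> Prop, (forall x, I x -> J x) -> forall m, E I m -> E J m) ->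
    (forall I, is_ideal I -> forall m m', (m <= m')%MM -> E I m -> E I m') ->
    (forall I J, is_ideal I -> is_ideal J -> (forall x, I x -> J x) ->
       (forall m, E J m -> E I m) -> forall x, J x -> I x) ->
  noetherian R.
Proof.
move=> Emono Eup Estrict F Fid [I0 FI0]; apply: contrapT => nomax.
(* Without a maximal member, each member of F has a larger one with a new leading exponent. In the
   resulting chain [Dickson] finds two such exponents, the earlier below the later, so the later one
   was not new. *)
have next (I : {I | F I}) : exists Jm : {J | F J} * 'X_{1..d},
    (forall x, sval I x -> sval Jm.1 x) /\ (E (sval Jm.1) Jm.2 /\ ~ E (sval I) Jm.2).
  apply: contrapT => noJ; apply: nomax; exists (sval I); split; first exact: svalP.
  move=> J FJ IJ; apply: Estrict => //; try exact/Fid/svalP; first exact: Fid.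
  move=> m EJ; apply: contrapT => NEI; apply: noJ.
  by exists (exist F J FJ, m).
have [nx nxP] := boolp.choice next.
pose s := fix s i := if i is i'.+1 then (nx (s i')).1 else exist F I0 FI0.
have smono i j x : (i <= j)%N -> sval (s i) x -> sval (s j) x.
  elim: j => [|j IHj]; first by rewrite leqn0 => /eqP->.
  rewrite leq_eqVlt => /predU1P[->//|/IHj ij /ij].
  exact: (nxP (s j)).1.
have [i [j [ij mij]]] := Dickson (fun i => (nx (s i)).2).
apply: ((nxP (s j)).2.2); apply: Eup mij _; first exact/Fid/svalP.
apply: Emono (nxP (s i)).2.1 => x; exact: (smono i.+1 j).
Qed.

(** Ideals I in J with the same leading exponents agree: subtracting a multiple of an element of I
    lowers the leading exponent of an element of J. *)
Theorem noetherian_mpoly (K : fieldType) (d : nat) : noetherian {mpoly K[d]}.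
Proof.
apply: (@noetherian_exponents _ d
  (fun I m => exists f, [/\ I f, f != 0 & mlead f = m])).
- by move=> I J IJ m [f [If f0 fm]]; exists f; split=> //; apply: IJ.
- move=> I [_ _ IM] m m' mm' [f [If f0 fm]]; exists ('X_[m' - m] * f).
  have X0 : 'X_[m' - m] != 0 :> {mpoly K[d]}.
    by rewrite -msupp_eq0 msuppX.
  split; [exact: IM | exact: mulf_neq0 |].
  by rewrite mleadM // mleadXm fm submK.
move=> I J [I0 ID IM] [_ JD JM] IJ EJI f.
move: {2}(mlead f) (erefl (mlead f)) => m fm; move: m f fm.
apply: (@ltmwf d (fun m => forall f, mlead f = m -> J f -> I f)) => m IHm f fm Jf.
have [->//|f0] := eqVneq f 0.
have [|g [Ig g0 gm]] := EJI m; first by exists f.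
pose c : K := mleadc f / mleadc g.
have -> : f = (f - c%:MP * g) + c%:MP * g by rewrite subrK.
apply: (ID); last exact: IM.
have Jh : J (f - c%:MP * g).
  by apply: (JD) => //; rewrite -mulNr; apply/JM/IJ.
have [->//|h0] := eqVneq (f - c%:MP * g) 0.
apply: (IHm (mlead (f - c%:MP * g))) => //.
rewrite lt_neqAle; apply/andP; split; last first.
  rewrite (le_trans (mleadB_le _ _)) // leUx fm lexx mul_mpolyC.
  by rewrite -gm mleadZ_le.
apply/eqP => e; have /negP[] := h0; rewrite -mleadc_eq0 e mcoeffB mcoeffCM.
by rewrite /c fm gm divfK ?subrr // -gm mleadc_eq0.
Qed.

Section SeriesOfPolynomial.
Variables (k : comNzRingType) (d : nat).
Local Notation ps := (mpseries k d).
Implicit Types (F G : ps) (p q : {mpoly k[d]}) (m a : 'X_{1..d}).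

Definition mps_of p : ps := fun m => p@_m.

Fact mps_of_zmod : zmod_morphism mps_of.
Proof. by move=> p q; apply/funext => m; apply: mcoeffB. Qed.
Fact mps_of_monoid : monoid_morphism mps_of.
Proof.
split=> [|p q]; apply/funext => m; first exact: mcoeff1.
by rewrite /mps_of -(@mps_mul_mpoly _ _ _ _ (mps_of p) (mps_of q)).
Qed.
HB.instance Definition _ := GRing.isZmodMorphism.Build {mpoly k[d]} ps mps_of
  mps_of_zmod.
HB.instance Definition _ := GRing.isMonoidMorphism.Build {mpoly k[d]} ps mps_of
  mps_of_monoid.

Definition mps_X a : ps := mps_of 'X_[a].

Lemma mps_XE a m : mps_X a m = (a == m)%:R.
Proof. exact: mcoeffX. Qed.

Lemma mps_addE F G m : (F + G) m = F m + G m. Proof. by []. Qed.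
Lemma mps_oppE F m : (- F) m = - F m. Proof. by []. Qed.

Lemma mps_sumE (I : Type) (r : seq I) (P : pred I) (E : I -> ps) m :
  (\sum_(i <- r | P i) E i) m = \sum_(i <- r | P i) E i m.
Proof. by apply: (big_morph (fun F : ps => F m)). Qed.

Lemma mps_mulE F G m : (F * G) m =
  \sum_(u : 'X_{1..d < (mdeg m).+1, (mdeg m).+1} | m == (u.1 + u.2)%MM)
    F u.1 * G u.2.
Proof. by []. Qed.

Lemma mps_mul_mpolyE F G (p q : {mpoly k[d]}) m :
  (forall u, (mdeg u <= mdeg m)%N -> p@_u = F u) ->
  (forall u, (mdeg u <= mdeg m)%N -> q@_u = G u) -> (F * G) m = (p * q)@_m.
Proof. exact: mps_mul_mpoly. Qed.

Lemma mps_mulX a F m : (mps_X a * F) m = if (a <= m)%MM then F (m - a)%MM else 0.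
Proof.
case: ifP => am.
  pose q := mps_trunc (mdeg m).+1 F.
  rewrite (@mps_mul_mpolyE _ _ 'X_[a] q) // => [|u um]; last by rewrite mps_truncE.
  by rewrite mulrC -{1}(submK am) addmC mcoeffMX mps_truncE // ltnS mdegB.
rewrite mps_mulE big1 // => u /eqP mu; rewrite mps_XE.
by case: eqP => [au|_]; rewrite ?mul0r //; rewrite mu au lem_addr in am.
Qed.

End SeriesOfPolynomial.

(** Well-founded recursion on the monomial order. [Fix] supplies c only below m; elsewhere the value
    x0 is used, which does not affect H at m. *)
Lemma mnm_wf_fixpoint (d : nat) (T : Type) (x0 : T)
    (H : ('X_{1..d} -> T) -> 'X_{1..d} -> T) :
  (forall c c' m, (forall m', (m' < m)%O -> c m' = c' m') -> H c m = H c' m) ->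
  exists c, forall m, c m = H c m.
Proof.
move=> Hext.
pose G m (c : forall m', (m' < m)%O -> T) := H (fun m' =>
  if (m' < m)%O =P true is ReflectT h then c m' h else x0) m.
exists (Fix (@ltom_wf d) (fun=> T) G) => m; rewrite Fix_eq.
  by apply: Hext => m' m'm; case: eqP.
by move=> {}m f g fg; congr (H _ m); apply/funext => m'; case: eqP.
Qed.

Section SeriesNoetherian.
Variables (K : fieldType) (d : nat).
Local Notation ps := (mpseries K d).
Implicit Types (F G : ps) (m l a : 'X_{1..d}).

(** A series may have no largest exponent, so the leading exponent is the smallest one. *)
Definition mps_lead F m := F m != 0 /\ forall m', (m' < m)%O -> F m' = 0.

Lemma mps_lead_exists F : F != 0 -> exists m, mps_lead F m.
Proof.
move=> F0; apply: contrapT => nolead; case/eqP: F0; apply/funext.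
apply: (@ltmwf d (fun m => F m = 0)) => m IHm; apply: contrapT => /eqP Fm.
by apply: nolead; exists m.
Qed.

(** Cancelling leading terms need not terminate for series. Instead an element of J is divided by
    finitely many g l in I, and all quotients are found at once by solving a fixpoint equation. *)
Theorem noetherian_mpseries : noetherian ps.
Proof.
apply: (@noetherian_exponents _ d (fun I m => exists2 F, I F & mps_lead F m)).
- by move=> I J IJ m [F If Fm]; exists F => //; apply: IJ.
- move=> I [_ _ IM] m m' mm' [F If [Fm Flt]].
  exists (mps_X K (m' - m) * F); first exact: IM.
  have m'E : m' = (m' - m + m)%MM by rewrite submK.
  split=> [|n nm']; rewrite mps_mulX.
    by rewrite lem_subr {1}m'E addmC addmK.
  case: ifP => // le_n; apply: Flt.
  by rewrite -(ltmc_add2l _ _ (m' - m)%MM) submK // addmC submK.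
move=> I J Iid [J0 JD JM] IJ EJI F JF; have [I0 ID IM] := Iid.
have [ls [lsE Els]] := finite_monomial_basis (fun m => exists2 F, I F & mps_lead F m).
have /boolp.choice[g gP] l : exists g : ps, l \in ls ->
    [/\ I g, g l = 1 & forall m, (m < l)%O -> g m = 0].
  case: (boolP (l \in ls)) => [/lsE[G IG [Gl Glt]]|_]; last by exists 0.
  exists (mps_of (G l)^-1%:MP * G) => _.
  have E m : (mps_of (G l)^-1%:MP * G) m = (G l)^-1 * G m.
    rewrite (@mps_mul_mpolyE _ _ _ _ (G l)^-1%:MP (mps_trunc (mdeg m).+1 G)) //.
      by rewrite mcoeffCM mps_truncE.
    by move=> u um; rewrite mps_truncE.
  split; [exact: IM | by rewrite E mulVf | by move=> m /Glt Gm; rewrite E Gm mulr0].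
(* [lo m] selects the generator that takes care of the exponent m, and [q c l] gathers the c m with
   lo m = l, shifted down by l. Thus Q c has coefficient c m at such m, up to terms in c at smaller
   exponents. *)
pose lo m := nth 0%MM ls (find (fun l => (l <= m)%MM) ls).
pose q (c : ps) l : ps := fun a => if lo (a + l)%MM == l then c (a + l)%MM else 0.
pose Q (c : ps) : ps := \sum_(l <- undup ls) q c l * g l.
pose inE m := has (fun l => (l <= m)%MM) ls.
have Qlow (c : ps) m : (forall m', (m' < m)%O -> c m' = 0) ->
    Q c m = if inE m then c m else 0.
  move=> clow; rewrite /Q mps_sumE.
  have term l : l \in ls ->
      (q c l * g l) m = if (l <= m)%MM && (lo m == l) then c m else 0.
    move=> /gP[_ gl glow]; transitivity ((q c l * mps_X K l) m).
      rewrite !mps_mulE; apply: eq_bigr => u /eqP mu; rewrite mps_XE.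
      have [<-|lu] := eqVneq l (u.2 : 'X_{1..d}); first by rewrite gl.
      rewrite mulr0; have [ul|] := leP l (u.2 : 'X_{1..d}); last first.
        by move=> /glow->; rewrite mulr0.
      suff -> : q c l u.1 = 0 by rewrite mul0r.
      rewrite /q; case: ifP => // _; apply: clow.
      by rewrite [X in (_ < X)%O]mu ltmc_add2r lt_neqAle lu.
    rewrite mulrC mps_mulX; case: ifP => //= lm; rewrite /q submK //.
  rewrite big_seq (eq_bigr (fun l => if (l <= m)%MM && (lo m == l) then c m else 0));
    last by move=> l; rewrite mem_undup; apply: term.
  rewrite -big_seq; case: ifP => [Em|NEm]; last first.
    rewrite big_seq big1 // => l; rewrite mem_undup => ls_l.
    by case: ifP => // /andP[lm _]; move/hasPn: (negbT NEm) => /(_ l ls_l); rewrite lm.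
  have lols : lo m \in ls by rewrite mem_nth // -has_find.
  rewrite (bigD1_seq (lo m)) ?undup_uniq ?mem_undup //= big1 => [|l ll].
    by rewrite (nth_find 0%MM Em) eqxx addr0.
  by rewrite eq_sym (negPf ll) andbF.
have QB c c' : Q c - Q c' = Q (c - c').
  rewrite /Q -sumrB; apply: eq_bigr => l _; rewrite -mulrBl; congr (_ * _).
  apply/funext => a; rewrite /q !mps_addE !mps_oppE.
  by case: ifP; rewrite ?subrr.
(* At an exponent m above some l the equation says Q c m = F m. Its right side depends on c only
   below m, as the contribution of c m to Q c m is added back. *)
have [|c cP] := @mnm_wf_fixpoint d K 0
    (fun c m => F m - Q c m + if inE m then c m else 0).
  move=> c c' m cc'.
  have e : (Q c - Q c') m = if inE m then ((c : ps) - (c' : ps)) m else 0.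
    by rewrite QB; apply: Qlow => m' /cc' e; rewrite mps_addE mps_oppE e subrr.
  apply/eqP; rewrite -subr_eq0; apply/eqP; move: e.
  rewrite !mps_addE !mps_oppE.
  by case: ifP => _ /eqP; rewrite subr_eq => /eqP ->; ring.
have IQ : I (Q c).
  rewrite /Q big_seq; apply: (big_ind I) => // l; rewrite mem_undup => /gP[Ig _ _].
  exact: IM.
suff -> : F = Q c by [].
apply/eqP; rewrite -subr_eq0; apply/negP => /negP /mps_lead_exists [m Fm].
have [|l ls_l lm] := Els m.
  apply: EJI; exists (F - Q c) => //; apply: (JD) => //.
  by rewrite -mulN1r; apply/JM/IJ.
have Em : inE m by apply/hasP; exists l.
case: Fm => /eqP[]; have := cP m; rewrite Em mps_addE mps_oppE => /eqP.
by rewrite -subr_eq subrr eq_sym => /eqP.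
Qed.

End SeriesNoetherian.

(** * Perfect closure *)

Section PerfectClosure.
Variables (k : fieldType) (p : nat) (charkp : p \in [pchar k]).
Local Open Scope quotient_scope.

Let pD e (x y : k) : (x + y) ^+ (p ^ e) = x ^+ (p ^ e) + y ^+ (p ^ e).
Proof. exact: pchar_expD charkp e x y. Qed.

Let pN e (x : k) : (- x) ^+ (p ^ e) = - x ^+ (p ^ e).
Proof.
apply: (addIr (x ^+ (p ^ e))); rewrite -pD !addNr expr0n expn_eq0.
by rewrite eqn0Ngt prime_gt0 // (pcharf_prime charkp).
Qed.

(* The pair (a, m) stands for the p^m-th root of a.                           *)
Definition root_rel (x y : k * nat) : bool :=
  x.1 ^+ (p ^ y.2) == y.1 ^+ (p ^ x.2).

Fact root_rel_refl : reflexive root_rel.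
Proof. by move=> x; apply: eqxx. Qed.
Fact root_rel_sym : ssrbool.symmetric root_rel.
Proof. by move=> x y; rewrite /root_rel eq_sym. Qed.
Fact root_rel_trans : transitive root_rel.
Proof.
move=> [b n] [a m] [c l] /eqP /= e1 /eqP /= e2.
apply/eqP/(pchar_exp_inj (e := n) charkp) => /=.
by rewrite -!exprM mulnC exprM e1 -exprM mulnC exprM e2 -exprM mulnC.
Qed.

Canonical root_equiv := EquivRel root_rel root_rel_refl root_rel_sym root_rel_trans.

Definition perfect_closure := {eq_quot root_equiv}.

HB.instance Definition _ := Choice.on perfect_closure.
HB.instance Definition _ := EqQuotient.on perfect_closure.

Definition proot (a : k) (m : nat) : perfect_closure := \pi_perfect_closure (a, m).

Lemma prootP a m b n : proot a m = proot b n <-> a ^+ (p ^ n) = b ^+ (p ^ m).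
Proof.
by split=> [/eqP|e]; last apply/eqP; rewrite eqmodE; [move/eqP | apply/eqP].
Qed.

Lemma prootW (x : perfect_closure) : exists a m, x = proot a m.
Proof.
by exists (repr x).1, (repr x).2; rewrite /proot -surjective_pairing reprK.
Qed.

Lemma repr_proot a m : exists b n,
  repr (proot a m) = (b, n) /\ b ^+ (p ^ m) = a ^+ (p ^ n).
Proof.
case e: (repr (proot a m)) => [b n]; exists b, n; split => //.
by apply/prootP; rewrite {1}/proot -e reprK.
Qed.

Definition pc_add (x y : perfect_closure) : perfect_closure :=
  let: ((a, m), (b, n)) := (repr x, repr y) in
  proot (a ^+ (p ^ n) + b ^+ (p ^ m)) (m + n).
Definition pc_opp (x : perfect_closure) : perfect_closure :=
  let: (a, m) := repr x in proot (- a) m.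
Definition pc_mul (x y : perfect_closure) : perfect_closure :=
  let: ((a, m), (b, n)) := (repr x, repr y) in
  proot (a ^+ (p ^ n) * b ^+ (p ^ m)) (m + n).
Definition pc_inv (x : perfect_closure) : perfect_closure :=
  let: (a, m) := repr x in proot a^-1 m.

Lemma pc_addE a m b n : pc_add (proot a m) (proot b n) =
  proot (a ^+ (p ^ n) + b ^+ (p ^ m)) (m + n).
Proof.
rewrite /pc_add; have [a' [m' [-> ea]]] := repr_proot a m.
have [b' [n' [-> eb]]] := repr_proot b n.
apply/prootP; rewrite !pD -!exprM -!expnD; congr (_ + _).
  rewrite (_ : n' + (m + n) = m + (n' + n))%N; last by ring.
  rewrite expnD exprM ea -exprM -expnD; congr (_ ^+ (_ ^ _)); ring.
rewrite (_ : m' + (m + n) = n + (m' + m))%N; last by ring.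
rewrite expnD exprM eb -exprM -expnD; congr (_ ^+ (_ ^ _)); ring.
Qed.

Lemma pc_oppE a m : pc_opp (proot a m) = proot (- a) m.
Proof.
rewrite /pc_opp; have [a' [m' [-> ea]]] := repr_proot a m.
by apply/prootP; rewrite !pN ea.
Qed.

Lemma pc_mulE a m b n : pc_mul (proot a m) (proot b n) =
  proot (a ^+ (p ^ n) * b ^+ (p ^ m)) (m + n).
Proof.
rewrite /pc_mul; have [a' [m' [-> ea]]] := repr_proot a m.
have [b' [n' [-> eb]]] := repr_proot b n.
apply/prootP; rewrite !exprMn -!exprM -!expnD; congr (_ * _).
  rewrite (_ : n' + (m + n) = m + (n' + n))%N; last by ring.
  rewrite expnD exprM ea -exprM -expnD; congr (_ ^+ (_ ^ _)); ring.
rewrite (_ : m' + (m + n) = n + (m' + m))%N; last by ring.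
rewrite expnD exprM eb -exprM -expnD; congr (_ ^+ (_ ^ _)); ring.
Qed.

Lemma pc_invE a m : pc_inv (proot a m) = proot a^-1 m.
Proof.
rewrite /pc_inv; have [a' [m' [-> ea]]] := repr_proot a m.
by apply/prootP; rewrite !exprVn ea.
Qed.

Lemma proot_scale a m n : proot a m = proot (a ^+ (p ^ n)) (m + n).
Proof. by apply/prootP; rewrite -exprM -expnD addnC. Qed.

(** With a common exponent m, [proot ^~ m] is additive and multiplicative, which reduces the ring
    laws to those of k. *)
Lemma prootW2 x y : exists a b m, x = proot a m /\ y = proot b m.
Proof.
have [[a [m ->]] [b [n ->]]] := (prootW x, prootW y).
exists (a ^+ (p ^ n)), (b ^+ (p ^ m)), (m + n)%N.
by rewrite [proot b n](proot_scale _ _ m) -proot_scale addnC.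
Qed.

Lemma prootW3 x y z : exists a b c m, [/\ x = proot a m, y = proot b m & z = proot c m].
Proof.
have [[a [b [m [-> ->]]]] [c [n ->]]] := (prootW2 x y, prootW z).
exists (a ^+ (p ^ n)), (b ^+ (p ^ n)), (c ^+ (p ^ m)), (m + n)%N.
by split; rewrite -?proot_scale // [proot c n](proot_scale _ _ m) addnC.
Qed.

Lemma proot_add a b m : pc_add (proot a m) (proot b m) = proot (a + b) m.
Proof. by rewrite pc_addE -pD -proot_scale. Qed.

Lemma proot_mul a b m : pc_mul (proot a m) (proot b m) = proot (a * b) m.
Proof. by rewrite pc_mulE -exprMn -proot_scale. Qed.

Lemma proot0 m : proot 0 0 = proot 0 m.
Proof.
apply/prootP; rewrite expr1 expr0n expn_eq0 eqn0Ngt.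
by rewrite prime_gt0 // (pcharf_prime charkp).
Qed.

Lemma proot1 m : proot 1 0 = proot 1 m.
Proof. by apply/prootP; rewrite !expr1n. Qed.

Fact pc_addA : associative pc_add.
Proof.
move=> x y z; have [a [b [c [m [-> -> ->]]]]] := prootW3 x y z.
by rewrite !proot_add addrA.
Qed.
Fact pc_addC : commutative pc_add.
Proof.
move=> x y; have [a [b [m [-> ->]]]] := prootW2 x y.
by rewrite !proot_add addrC.
Qed.
Fact pc_add0 : left_id (proot 0 0) pc_add.
Proof.
by move=> x; have [a [m ->]] := prootW x; rewrite (proot0 m) proot_add add0r.
Qed.
Fact pc_addN : left_inverse (proot 0 0) pc_opp pc_add.
Proof.
by move=> x; have [a [m ->]] := prootW x; rewrite pc_oppE proot_add addNr -proot0.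
Qed.

HB.instance Definition _ := GRing.isZmodule.Build perfect_closure
  pc_addA pc_addC pc_add0 pc_addN.

Fact pc_mulA : associative pc_mul.
Proof.
move=> x y z; have [a [b [c [m [-> -> ->]]]]] := prootW3 x y z.
by rewrite !proot_mul mulrA.
Qed.
Fact pc_mulC : commutative pc_mul.
Proof.
move=> x y; have [a [b [m [-> ->]]]] := prootW2 x y.
by rewrite !proot_mul mulrC.
Qed.
Fact pc_mul1 : left_id (proot 1 0) pc_mul.
Proof.
by move=> x; have [a [m ->]] := prootW x; rewrite (proot1 m) proot_mul mul1r.
Qed.
Fact pc_mulD : left_distributive pc_mul +%R.
Proof.
move=> x y z; have [a [b [c [m [-> -> ->]]]]] := prootW3 x y z.
by rewrite /+%R /= !(proot_mul, proot_add) mulrDl.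
Qed.
Fact pc_one_neq0 : proot 1 0 != 0.
Proof. by apply/eqP => /prootP/eqP; rewrite !expr1 oner_eq0. Qed.

HB.instance Definition _ := GRing.Zmodule_isComNzRing.Build perfect_closure
  pc_mulA pc_mulC pc_mul1 pc_mulD pc_one_neq0.

Fact pc_mulVf (x : perfect_closure) : x != 0 -> pc_inv x * x = 1.
Proof.
have [a [m ->]] := prootW x; rewrite pc_invE [_ * _]proot_mul => a0.
rewrite [1](proot1 m) mulVf //; apply: contraNneq a0 => ->.
by rewrite -proot0.
Qed.
Fact pc_inv0 : pc_inv 0 = 0.
Proof. by rewrite [pc_inv _]pc_invE invr0. Qed.

HB.instance Definition _ := GRing.ComNzRing_isField.Build perfect_closure
  pc_mulVf pc_inv0.

Definition pc_inj (a : k) : perfect_closure := proot a 0.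

Fact pc_inj_zmod : zmod_morphism pc_inj.
Proof.
move=> a b; rewrite /pc_inj -proot_add; congr (pc_add _ _).
by rewrite -pc_oppE.
Qed.
Fact pc_inj_monoid : monoid_morphism pc_inj.
Proof. by split=> // a b; rewrite /pc_inj -proot_mul. Qed.
HB.instance Definition _ := GRing.isZmodMorphism.Build k perfect_closure pc_inj
  pc_inj_zmod.
HB.instance Definition _ := GRing.isMonoidMorphism.Build k perfect_closure pc_inj
  pc_inj_monoid.

Lemma pc_root (x : perfect_closure) : exists y, y ^+ p = x.
Proof.
have [a [m ->]] := prootW x; exists (proot a m.+1).
have E n : proot a m.+1 ^+ n = proot (a ^+ n) m.+1.
  elim: n => [|n IHn]; first exact: proot1.
  by rewrite !exprS IHn -proot_mul.
by have := proot_scale a m 1; rewrite E expn1 addn1.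
Qed.

End PerfectClosure.

(** * A linear retraction of a field extension *)

Section Retraction.
Variables (k K : fieldType) (i : {rmorphism k -> K}).

(** A k-subspace V of K maximal among those without 1 is a complement of the image of k; rho is the
    projection along V. *)
Lemma field_retraction : exists rho : K -> k,
  [/\ {morph rho : x y / x + y}, forall a x, rho (i a * x) = a * rho x & rho 1 = 1].
Proof.
(* The empty V is allowed, so that the union of the empty chain qualifies; V 0 then follows from
   maximality. *)
pose P (V : K -> Prop) := ~ V 1 /\ forall a x y, V x -> V y -> V (x + i a * y).
have [F FP Ftot|V [[V1 VL] Vmax]] := @classical_sets.Zorn_bigcup K P.
  split=> [[W FW W1]|a x y [W FW Wx] [W' FW' W'y]]; first by case: (FP _ FW).
  have [WW'|W'W] := Ftot _ _ FW FW'.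
    by exists W' => //; apply: (FP _ FW').2 => //; apply: WW'.
  by exists W => //; apply: (FP _ FW).2 => //; apply: W'W.
have big (W : K -> Prop) : P W -> (forall x, V x -> W x) -> forall x, W x -> V x.
  move=> PW VW x Wx; apply: contrapT => NVx; apply: (Vmax W) PW; split=> //.
  by move=> WV; apply/NVx/WV.
have V0 : V 0.
  have [[x Vx]|noV] := pselect (exists x, V x).
    by have := VL (-1) x x Vx Vx; rewrite rmorphN1 mulN1r subrr.
  apply: (big (fun x => x = 0)) => // [|x Vx]; last by case: noV; exists x.
  by split=> [/eqP|a x y -> ->]; rewrite ?oner_eq0 // mulr0 addr0.
have VZ a x : V x -> V (i a * x) by move=> Vx; rewrite -[_ * _]add0r; apply: VL.
have VD x y : V x -> V y -> V (x + y).
  by move=> Vx Vy; rewrite -[y]mul1r -(rmorph1 i); apply: VL.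
(* If x is not in V, then V + k x contains 1, and 1 - c x in V is solved for x. *)
have split_off x : exists a, V (x - i a).
  have [Vx|NVx] := pselect (V x); first by exists 0; rewrite rmorph0 subr0.
  pose W z := exists c, V (z - i c * x).
  have [[c Vc]|W1] := pselect (W 1).
    have c0 : c != 0.
      by apply/eqP => c0; apply: V1; move: Vc; rewrite c0 rmorph0 mul0r subr0.
    exists c^-1; rewrite (_ : _ - _ = i (- c^-1) * (1 - i c * x)); first exact: VZ.
    rewrite rmorphN fmorphV mulrBr mulr1 mulNr mulrA mulVf ?fmorph_eq0 //.
    by rewrite mul1r opprK addrC.
  exfalso; apply/NVx/(big W); last by exists 1; rewrite rmorph1 mul1r subrr.
    split=> // a y z [c Vy] [c' Vz]; exists (c + a * c').
    rewrite (_ : _ - _ = (y - i c * x) + i a * (z - i c' * x)); first exact: VL.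
    by rewrite rmorphD rmorphM /=; ring.
  by move=> z Vz; exists 0; rewrite rmorph0 mul0r subr0.
have [rho rhoP] := boolp.choice split_off.
have rho_uniq x a : V (x - i a) -> rho x = a.
  move=> Va; apply/eqP; rewrite -subr_eq0; apply/eqP; apply: contrapT => /eqP d0.
  apply: V1; rewrite (_ : 1 =
    i (rho x - a)^-1 * ((x - i a) + i (-1) * (x - i (rho x)))).
    by apply/VZ/VL.
  rewrite rmorphN1 mulN1r opprB [X in _ * X]addrC addrA subrK -rmorphB.
  by rewrite fmorphV mulVf // fmorph_eq0.
exists rho; split=> [x y|a x|].
- by apply: rho_uniq; rewrite rmorphD opprD addrACA; apply: VD.
- by apply: rho_uniq; rewrite rmorphM -mulrBr; apply: VZ.
- by apply: rho_uniq; rewrite rmorph1 subrr.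
Qed.

End Retraction.

Theorem perfect_extension (k : fieldType) (p : nat) : p \in [pchar k] ->
  exists (K : fieldType) (i : {rmorphism k -> K}),
    (forall x : K, exists y, y ^+ p = x) /\
    exists rho : K -> k,
    [/\ {morph rho : x y / x + y}, forall a x, rho (i a * x) = a * rho x & rho 1 = 1].
Proof.
move=> charkp; exists (perfect_closure charkp), (@pc_inj k p charkp).
by split; [exact: pc_root | exact: field_retraction].
Qed.

(** * Frobenius on power series *)

Section Digits.
Variables (d q : nat).
Implicit Types (m : 'X_{1..d}).

Definition mnm_div m : 'X_{1..d} := [multinom (m i %/ q)%N | i < d].

Definition mnm_dvd m := [forall i, q %| m i]%N.

Lemma mnm_divK m : mnm_dvd m -> (mnm_div m *+ q)%MM = m.
Proof. by move=> /forallP qm; apply/mnmP => i; rewrite mulmnE mnmE divnK. Qed.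

Lemma mnm_mulK m : (0 < q)%N -> mnm_div (m *+ q) = m.
Proof. by move=> q0; apply/mnmP => i; rewrite mnmE mulmnE mulnK. Qed.

Lemma mnm_dvd_mull m : mnm_dvd (m *+ q).
Proof. by apply/forallP => i; rewrite mulmnE dvdn_mull. Qed.

Lemma mdeg_mulr_gt0 m : (0 < q)%N -> (mdeg m <= mdeg (m *+ q))%N.
Proof. by move=> q0; rewrite mdegMn leq_pmulr. Qed.

Definition mnm_digits (a : {ffun 'I_d -> 'I_q}) : 'X_{1..d} :=
  [multinom (a j : nat) | j < d].

(** Exactly one digit vector meets both conditions: the residues of m modulo q. This splits a series
    into monomials X^a times series supported on multiples of q. *)
Lemma sum_mnm_digits (V : nmodType) m (v : V) :
    (0 < q)%N ->
  \sum_(a : {ffun 'I_d -> 'I_q})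
    (if (mnm_digits a <= m)%MM && mnm_dvd (m - mnm_digits a) then v else 0) = v.
Proof.
move=> q_gt0.
pose a0 : {ffun 'I_d -> 'I_q} := [ffun j => Ordinal (ltn_pmod (m j) q_gt0)].
have a0m : (mnm_digits a0 <= m)%MM.
  by apply/mnm_lepP => j; rewrite mnmE ffunE leq_mod.
rewrite (bigD1 a0) //= a0m big1 ?addr0 => [|a aa0].
  rewrite ifT //; apply/forallP => j; rewrite mnmBE mnmE ffunE /=.
  by rewrite {1}(divn_eq (m j) q) addnK dvdn_mull.
case: ifP => // /andP[/mnm_lepP am /forallP qma]; case/eqP: aa0.
apply/ffunP => j; apply: val_inj; rewrite ffunE /=.
move: (am j) (qma j); rewrite mnmBE mnmE => ajm /dvdnP[n nE].
by rewrite -(subnK ajm) nE modnMDl modn_small.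
Qed.

End Digits.

Section FrobeniusSeries.
Variables (K : fieldType) (d p : nat).
Hypothesis charKp : p \in [pchar K].
Local Notation ps := (mpseries K d).
Implicit Types (F G : ps) (m : 'X_{1..d}).

Let p_gt0 : (0 < p)%N := prime_gt0 (pcharf_prime charKp).

Lemma pchar_mpseries : p \in [pchar ps].
Proof. by have := rmorph_pchar (GRing.in_alg ps) charKp. Qed.

Lemma mps_oneE m : (1 : ps) m = (m == 0%MM)%:R. Proof. by []. Qed.

Lemma mps_exp_mpoly n F (q : {mpoly K[d]}) m :
  (forall u, (mdeg u <= mdeg m)%N -> q@_u = F u) -> (F ^+ n) m = (q ^+ n)@_m.
Proof.
elim: n m => [|n IHn] m qF; first by rewrite !expr0 mcoeff1.
rewrite !exprS; apply: mps_mul_mpolyE => // u um; apply/esym/IHn => v vu.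
exact/qF/(leq_trans vu).
Qed.

(** After truncation F is a polynomial, and Frobenius is additive: F^(p^e) has terms F_u^(p^e) X^(u
    p^e). N is left free so that two such sums can share an index set. *)
Lemma mps_exp_mulE e N F G m : (mdeg m < N)%N ->
  (F ^+ (p ^ e) * G) m = \sum_(u : 'X_{1..d < N})
    F u ^+ (p ^ e) * (if (u *+ (p ^ e) <= m)%MM then G (m - u *+ (p ^ e))%MM else 0).
Proof.
move=> mN; transitivity ((mps_of (mps_trunc N F ^+ (p ^ e)) * G) m).
  rewrite !mps_mulE; apply: eq_bigr => u /eqP mu; congr (_ * _).
  apply: mps_exp_mpoly => v vu; rewrite mps_truncE //.
  apply: leq_ltn_trans mN; apply: leq_trans vu _.
  by rewrite [X in (_ <= mdeg X)%N]mu mdegD leq_addr.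
have charP : p \in [pchar {mpoly K[d]}].
  by have := rmorph_pchar (GRing.in_alg {mpoly K[d]}) charKp.
rewrite /mps_trunc (pchar_exp_sum charP) rmorph_sum mulr_suml mps_sumE.
apply: eq_bigr => u _; rewrite exprZn mpolyXn -mps_mulX -mul_mpolyC rmorphM /=.
rewrite -mulrA -/(mps_X _ _); set H := mps_X _ _ * G.
rewrite (@mps_mul_mpolyE _ _ _ _ (F u ^+ (p ^ e))%:MP (mps_trunc (mdeg m).+1 H)) //.
  by rewrite mcoeffCM mps_truncE.
by move=> v vm; rewrite mps_truncE.
Qed.

Lemma mps_expE e F m : (F ^+ (p ^ e)) m =
  if mnm_dvd (p ^ e) m then F (mnm_div (p ^ e) m) ^+ (p ^ e) else 0.
Proof.
have q_gt0 : (0 < p ^ e)%N by rewrite expn_gt0 p_gt0.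
rewrite -[F ^+ _]mulr1 (mps_exp_mulE _ _ _ (ltnSn (mdeg m))).
have val1 (u : 'X_{1..d}) :
    (if (u *+ (p ^ e) <= m)%MM then (1 : ps) (m - u *+ (p ^ e))%MM else 0) =
    ((u *+ (p ^ e))%MM == m)%:R.
  have [<-|um] := eqVneq (u *+ (p ^ e))%MM m.
    by rewrite lepm_refl mps_oneE -{1}[(u *+ _)%MM]add0m addmK eqxx.
  case: ifP => // le_um; rewrite mps_oneE; case: eqP => // mu0.
  by case/eqP: um; rewrite -[RHS](submK le_um) mu0 add0m.
under eq_bigr => u _ do rewrite val1.
case: ifP => [qm|Nqm]; last first.
  rewrite big1 // => u _; case: eqP => [um|_]; last by rewrite mulr0.
  by rewrite -um mnm_dvd_mull in Nqm.
have dm : (mdeg (mnm_div (p ^ e) m) < (mdeg m).+1)%N.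
  by rewrite ltnS -{2}(mnm_divK qm) mdeg_mulr_gt0.
rewrite (bigD1 (BMultinom dm)) //= mnm_divK // eqxx mulr1 big1 ?addr0 // => u um.
case: eqP => [e_um|_]; last by rewrite mulr0.
by case/eqP: um; apply: val_inj; rewrite /= -[X in mnm_div _ X]e_um mnm_mulK.
Qed.

End FrobeniusSeries.

(* Polynomials are the series with finite support: b = true selects           *)
(* polynomials and b = false all series.                                      *)
Definition fin_supp (b : bool) (T : nmodType) (d : nat) (F : 'X_{1..d} -> T) :=
  b -> exists N, forall m, (N <= mdeg m)%N -> F m = 0.

Lemma fin_supp_transfer b (T T' : nmodType) (d : nat) (F : 'X_{1..d} -> T)
    (G : 'X_{1..d} -> T') (g : 'X_{1..d} -> 'X_{1..d}) :
    (forall m, mdeg m <= mdeg (g m))%N -> (forall m, F (g m) = 0 -> G m = 0) ->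
  fin_supp b F -> fin_supp b G.
Proof.
move=> gm FG WF /WF[N NF]; exists N => m Nm.
exact/FG/NF/(leq_trans Nm).
Qed.

(** * Polynomial and power series rings treated together *)

Section SeriesRings.
Variables (k K : fieldType) (p d : nat) (b : bool).
Variables (R : comAlgType k) (RK : comNzRingType).
(** R and RK enter through their coefficient maps, which identify them with the series satisfying
    [fin_supp b]; maps between them are built by prescribing coefficients. *)
Variables (c : {rmorphism R -> mpseries k d}) (cK : {rmorphism RK -> mpseries K d}).
Variables (i : {rmorphism k -> K}) (rho0 : K -> k).
Hypotheses (charkp : p \in [pchar k]) (noethRK : noetherian RK).
Hypotheses (c_inj : injective c) (cK_inj : injective cK).
Hypothesis c_supp : forall r, fin_supp b (c r).
Hypothesis cK_supp : forall r, fin_supp b (cK r).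
Hypothesis c_onto : forall F : mpseries k d, fin_supp b F -> exists r, c r = F.
Hypothesis cK_onto : forall F : mpseries K d, fin_supp b F -> exists r, cK r = F.
Hypothesis c_scal : forall a : k, c a%:A = mps_of a%:MP.
Hypothesis perfectK : forall x : K, exists y, y ^+ p = x.
Hypothesis rho0D : {morph rho0 : x y / x + y}.
Hypothesis rho0M : forall a x, rho0 (i a * x) = a * rho0 x.
Hypothesis rho01 : rho0 1 = 1.

Let charKp : p \in [pchar K] := rmorph_pchar i charkp.
Let p_gt0 : (0 < p)%N := prime_gt0 (pcharf_prime charkp).
Let pe_gt0 e : (0 < p ^ e)%N. Proof. by rewrite expn_gt0 p_gt0. Qed.

Let charR : p \in [pchar R].
Proof. by have := rmorph_pchar (GRing.in_alg R) charkp. Qed.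

Let charRK : p \in [pchar RK].
Proof.
have /andP[p_pr /eqP p0] := pchar_mpseries d charKp.
by apply/andP; split=> //; apply/eqP/cK_inj; rewrite rmorph_nat p0 rmorph0.
Qed.

Lemma coef_section_c (T : Type) (F : T -> mpseries k d) :
  (forall t, fin_supp b (F t)) -> exists f : T -> R, forall t, c (f t) = F t.
Proof.
move=> WF; have /boolp.choice[f fE] t := c_onto (WF t).
by exists f.
Qed.

Lemma coef_section_cK (T : Type) (F : T -> mpseries K d) :
  (forall t, fin_supp b (F t)) -> exists f : T -> RK, forall t, cK (f t) = F t.
Proof.
move=> WF; have /boolp.choice[f fE] t := cK_onto (WF t).
by exists f.
Qed.

Let rootE e : exists r : K -> K, forall x, r x ^+ (p ^ e) = x.
Proof.
suff /boolp.choice[r rE] : forall x : K, exists y, y ^+ (p ^ e) = x by exists r.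
move=> x.
elim: e x => [|e IHe] x; first by exists x.
have [y <-] := perfectK x; have [z <-] := IHe y.
by exists z; rewrite expnSr exprM.
Qed.

Lemma fin_supp_X (T : fieldType) a : fin_supp b (mps_X T a : mpseries T d).
Proof.
move=> _; exists (mdeg a).+1 => m am; rewrite mps_XE; case: eqP => // e.
by rewrite e ltnn in am.
Qed.

Lemma coef_inclusion : exists iota : {rmorphism R -> RK},
  forall r, cK (iota r) = (fun m => i (c r m)).
Proof.
have [|f fE] := coef_section_cK (F := fun r m => i (c r m)).
  move=> r; apply: (fin_supp_transfer (g := id)) (c_supp r) => // m.
  by move=> ->; rewrite rmorph0.
have fz : zmod_morphism f.
  move=> x y; apply: cK_inj; rewrite rmorphB !fE; apply/funext => m.
  by rewrite rmorphB mps_addE mps_oppE rmorphB.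
have fm : monoid_morphism f.
  split=> [|x y]; apply: cK_inj; rewrite ?rmorph1 ?rmorphM !fE; apply/funext => m.
    by rewrite rmorph1 !mps_oneE rmorph_nat.
  by rewrite rmorphM !mps_mulE rmorph_sum; apply: eq_bigr => u _; rewrite rmorphM.
pose Z := GRing.isZmodMorphism.Build _ _ f fz.
pose M := GRing.isMonoidMorphism.Build _ _ f fm.
pose iota : {rmorphism R -> RK} := HB.pack f Z M.
by exists iota.
Qed.

Lemma coef_retraction (iota : {rmorphism R -> RK}) :
    (forall r, cK (iota r) = (fun m => i (c r m))) ->
  exists rho : RK -> R,
    [/\ {morph rho : y z / y + z}, forall r y, rho (iota r * y) = r * rho y &
        rho 1 = 1].
Proof.
move=> iotaE; have rho00 : rho0 0 = 0 by have := rho0M 0 0; rewrite mulr0 mul0r.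
have [|rho rhoE] := coef_section_c (F := fun s m => rho0 (cK s m)).
  by move=> s; apply: (fin_supp_transfer (g := id)) (cK_supp s) => // m ->.
exists rho; split=> [y z|r y|]; apply: c_inj; rewrite ?rmorphD ?rmorphM ?rmorph1 !rhoE;
  apply/funext => m.
- by rewrite rmorphD !mps_addE rho0D.
- rewrite rmorphM iotaE !mps_mulE (big_morph rho0 rho0D rho00).
  by apply: eq_bigr => u _; rewrite rho0M.
- by rewrite rmorph1 !mps_oneE; case: eqP.
Qed.

(** Tr picks the coefficients at p m + (p-1, ..., p-1) and takes p-th roots. It generates since h is
    the sum over digit vectors a of X^a Tr(X^(p-1-a) h)^p. *)
Lemma Cartier_trace : exists Tr : RK -> RK,
  [/\ {morph Tr : y z / y + z}, forall r y, Tr (r ^+ p * y) = r * Tr y &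
      forall h, exists s : seq (RK * RK),
        h = \sum_(j <- s) j.1 * Tr (j.2 * h) ^+ p].
Proof.
have [rt rtE] := rootE 1; rewrite expn1 in rtE.
have root1_inj : injective (fun x : K => x ^+ p).
  by have := pchar_exp_inj (e := 1) charKp; rewrite expn1.
pose top : 'X_{1..d} := [multinom p.-1 | _ < d].
have [|Tr TrE] := coef_section_cK (F := fun s m => rt (cK s (m *+ p + top)%MM)).
  move=> s; apply: (fin_supp_transfer (g := fun m => (m *+ p + top)%MM)) (cK_supp s) => m.
    by rewrite mdegD (leq_trans _ (leq_addr _ _)) // mdeg_mulr_gt0.
  by move=> e; apply: root1_inj; rewrite /= rtE expr0n eqn0Ngt p_gt0.
have [Xr XrE] := coef_section_cK (fun a => @fin_supp_X K a).
exists Tr; split.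
- move=> y z; apply: cK_inj; rewrite rmorphD !TrE; apply/funext => m.
  apply: root1_inj; rewrite /= rmorphD !mps_addE.
  by have := pchar_expD charKp 1; rewrite expn1 => ->; rewrite !rtE.
- move=> r y; apply: cK_inj; rewrite rmorphM TrE; apply/funext => m.
  apply: root1_inj; rewrite /= rtE rmorphM rmorphXn.
  have md : (mdeg m < (mdeg (m *+ p + top)).+1)%N.
    by rewrite ltnS mdegD (leq_trans (mdeg_mulr_gt0 m p_gt0)) // leq_addr.
  have := mps_exp_mulE charKp 1 (cK r) (cK y) (ltnSn (mdeg (m *+ p + top))).
  rewrite expn1 => ->.
  (* With exponent p^0 = 1 the same formula expands an ordinary product over the same range of u, so
     the two sums are compared termwise. *)
  have := mps_exp_mulE charKp 0 (cK r) (cK (Tr y)) md; rewrite expn0 expr1 => ->.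
  have := pchar_exp_sum charKp 1; rewrite expn1 => ->; apply: eq_bigr => u _.
  rewrite expr1 exprMn mulm1n; congr (_ * _).
  (* Adding p - 1 to a multiple of p does not reach the next multiple. *)
  have le_iff : (u *+ p <= m *+ p + top)%MM = (u <= m)%MM.
    apply/mnm_lepP/mnm_lepP => um j; have := um j.
      rewrite mnmDE !mulmnE mnmE => ump.
      rewrite leqNgt; apply/negP => lt_mu; have := leq_mul lt_mu (leqnn p).
      by rewrite mulSn leqNgt -{3}(prednK p_gt0) addSn ltnS addnC ump.
    rewrite mnmDE !mulmnE => /leq_mul/(_ (leqnn p)) /leq_trans; apply.
    exact: leq_addr.
  rewrite le_iff; case: ifP => [um|_]; last by rewrite expr0n eqn0Ngt p_gt0.
  rewrite TrE rtE; congr (cK y _); apply/mnmP => j.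
  move/mnm_lepP: um => /(_ j) um.
  by rewrite !(mnmDE, mnmBE, mulmnE) mulnBl addnBAC // leq_mul2r um orbT.
move=> h; pose A := {ffun 'I_d -> 'I_p}.
pose hi (a : A) : 'X_{1..d} := [multinom (p.-1 - a j)%N | j < d].
exists [seq (Xr (mnm_digits a), Xr (hi a)) | a : A]; apply: cK_inj.
rewrite rmorph_sum big_map big_enum /=; apply/funext => m; rewrite mps_sumE.
rewrite -[LHS](sum_mnm_digits m _ p_gt0); apply: eq_bigr => a _.
rewrite rmorphM XrE mps_mulX rmorphXn.
have := mps_expE charKp 1 (cK (Tr (Xr (hi a) * h))) (m - mnm_digits a)%MM.
rewrite expn1 => ->; case: (boolP (mnm_digits a <= m)%MM) => //= am.
case: ifP => // pma; rewrite TrE rtE mnm_divK // rmorphM XrE mps_mulX.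
have -> : top = (mnm_digits a + hi a)%MM.
  by apply/mnmP => j; rewrite !(mnmDE, mnmE) subnKC // -ltnS prednK.
by rewrite addmA submK // lem_addl addmK.
Qed.

(** r is the sum of X^a t_a over digit vectors a, with t_a supported on exponents divisible by q.
    Over the perfect field K, t_a is the q-th power of a series whose coefficients are q-th
    roots. *)
Lemma pth_power_generated (iota : {rmorphism R -> RK}) :
    (forall r, cK (iota r) = (fun m => i (c r m))) ->
  exists x : 'I_d -> R, forall e r,
    generated x (fun m => exists y, iota m = y ^+ (p ^ e)) r.
Proof.
move=> iotaE; have [Xr XrE] := coef_section_c (fun a => @fin_supp_X k a).
pose x j := Xr U_(j)%MM; exists x => e r.
have q_gt0 := pe_gt0 e; set q := (p ^ e)%N in q_gt0 *; set S := fun _ => _.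
have [rt rtE] := rootE e.
have S1 : S 1 by exists 1; rewrite rmorph1 expr1n.
have S0 : S 0 by exists 0; rewrite rmorph0 expr0n eqn0Ngt q_gt0.
have gen_X a : generated x S (Xr a).
  have -> : Xr a = \prod_j x j ^+ a j.
    apply: c_inj; rewrite XrE /mps_X mpolyXE_id !rmorph_prod; apply: eq_bigr => j _.
    by rewrite !rmorphXn; congr (_ ^+ _); rewrite XrE.
  apply: (big_ind (generated x S)) => [||j _].
  - exact: GeneratedBase.
  - exact: GeneratedM.
  elim: (a j) => [|n IHn]; first exact: GeneratedBase.
  by rewrite exprS; apply: GeneratedM => //; apply: GeneratedVar.
have [|t tE] := coef_section_c (F := fun (a : {ffun 'I_d -> 'I_q}) m =>
    if mnm_dvd q m then c r (m + mnm_digits a)%MM else 0).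
  move=> a; apply: (fin_supp_transfer (g := fun m => (m + mnm_digits a)%MM)) (c_supp r).
    by move=> m; rewrite mdegD leq_addr.
  by move=> m ->; case: ifP.
have -> : r = \sum_a Xr (mnm_digits a) * t a.
  apply: c_inj; rewrite rmorph_sum; apply/funext => m; rewrite mps_sumE.
  rewrite -[LHS](sum_mnm_digits m _ q_gt0); apply: eq_bigr => a _.
  rewrite rmorphM XrE mps_mulX tE.
  case: (boolP (mnm_digits a <= m)%MM) => //= am.
  by rewrite submK.
apply: (big_ind (generated x S)) => [||a _]; [exact: GeneratedBase|exact: GeneratedD|].
apply: GeneratedM => //; apply: GeneratedBase.
have [|y yE] := cK_onto (F := fun m => rt (i (c r (m *+ q + mnm_digits a)%MM))).
  apply: (fin_supp_transfer (g := fun m => (m *+ q + mnm_digits a)%MM)) (c_supp r) => m.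
    by rewrite mdegD (leq_trans _ (leq_addr _ _)) // mdeg_mulr_gt0.
  move=> ->; apply: (pchar_exp_inj (e := e) charKp).
  by rewrite /= rtE rmorph0 expr0n eqn0Ngt q_gt0.
exists y; apply: cK_inj; rewrite rmorphXn iotaE yE; apply/funext => m.
rewrite (mps_expE charKp) tE -/q; case: ifP => [qm|_]; last by rewrite rmorph0.
by rewrite rtE mnm_divK.
Qed.

Theorem series_localization_generated (f : R) (y : localization f) :
  exists u : diffop R, y = u *: locfrac f 1 1.
Proof.
have [iota iotaE] := coef_inclusion.
have [rho [rhoD rhoM rho1]] := coef_retraction iotaE.
have [Tr [TrD TrM Tr_gen]] := Cartier_trace.
have [x gen] := pth_power_generated iotaE.
apply: (localization_generated charR charRK rhoD rhoM rho1 noethRK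
  TrD TrM Tr_gen _ gen).
move=> e a; have [rt rtE] := rootE e.
have [|y' y'E] := cK_onto (F := mps_of (rt (i a))%:MP).
  move=> _; exists 1%N => m; case: (m =P 0%MM) => [->|m0 _]; first by rewrite mdeg0.
  by rewrite /mps_of mcoeffC; case: eqP => // _; rewrite mulr0.
exists y'; apply: cK_inj; rewrite rmorphXn iotaE y'E c_scal -!rmorphXn rtE.
by apply/funext => m; rewrite /mps_of mcoeffC rmorphM rmorph_nat; apply/esym/mcoeffC.
Qed.

End SeriesRings.

Theorem theorem1p1 (k : fieldType) (p : nat) (d : nat) (hp : p \in [pchar k]) :
  (forall f : {mpoly k[d]}, f != 0 ->
     forall y : localization f,
       exists u : diffop {mpoly k[d]}, y = u *: locfrac f 1 1) /\
  (forall f : mpseries k d, f != 0 ->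
     forall y : localization f,
       exists u : diffop (mpseries k d), y = u *: locfrac f 1 1).
Proof.
have [K [i [perfectK [rho [rhoD rhoM rho1]]]]] := perfect_extension hp.
split=> f _ y.
  have mps_of_inj (T : fieldType) : injective (@mps_of T d).
    by move=> g h gh; apply/mpolyP => m; have := congr1 (fun F => F m) gh.
  have mps_of_supp (T : fieldType) (g : {mpoly T[d]}) : fin_supp true (mps_of g).
    move=> _; exists (msize g) => m gm; apply/eqP.
    by rewrite /mps_of mcoeff_eq0; apply/negP => /msize_mdeg_lt; rewrite ltnNge gm.
  have mps_of_onto (T : fieldType) (F : mpseries T d) :
      fin_supp true F -> exists g : {mpoly T[d]}, mps_of g = F.
    case=> // N FN; exists (mps_trunc N F); apply/funext => m; rewrite /mps_of.
    have [Nm|mN] := leqP N (mdeg m); last exact: mps_truncE.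
    rewrite FN // /mps_trunc raddf_sum big1 //= => u _.
    rewrite mcoeffZ mcoeffX; case: eqP => [um|_]; last by rewrite mulr0.
    by have := bmdeg u; rewrite um ltnNge Nm.
  apply: (@series_localization_generated k K p d true {mpoly k[d]} {mpoly K[d]}
    (@mps_of k d) (@mps_of K d) i rho) => //.
  - exact: noetherian_mpoly.
  - exact: mps_of_inj.
  - exact: mps_of_inj.
  - exact: mps_of_supp.
  - exact: mps_of_supp.
  - exact: mps_of_onto.
  - exact: mps_of_onto.
  - by move=> a; rewrite -mul_mpolyC mulr1.
apply: (@series_localization_generated k K p d false (mpseries k d) (mpseries K d)
  idfun idfun i rho) => //.
- exact: noetherian_mpseries.
- by move=> F _; exists F.
- by move=> F _; exists F.
- by move=> a; apply/funext => m; rewrite /mps_of mcoeffC.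
Qed.
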